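(* Let $X$ be a conditional $\mathbf{R}$-vector space and $k:X\to\mathbf{R}$ a conditionally convex function. Let $Y\in S(X)$ be a conditional subspace of $X$ and $f:Y\to\mathbf{R}$ a conditionally linear function such that $f(y)\leqslant k(y)$ for every $y\in Y$. Then there exists a conditionally linear function $\hat f:X\to\mathbf{R}$ such that $\hat f(x)\leqslant k(x)$ for every $x\in X$ and $\hat f(y)=f(y)$ for all $y\in Y$.
   Context: $\mathcal{A}$ is a complete Boolean algebra with $0\ne1$; $p(a)$ is the set of families $(a_i)$ with $\bigvee a_i=a$, $a_i\wedge a_j=0$ ($i\ne j$). Conditional sets $X=(X_a,\gamma_a)_{a\in\mathcal A}$ are families of sets with surjections $\gamma_a:X_1\to X_a$ ($X_0$ a singleton, $\gamma_1=\mathrm{id}$), consistent and stable (unique gluing $\sum a_ix_i$ over $(a_i)\in p(1)$). Conditional functions are families $f_a:X_a\to Y_a$ with $f_a(ax)=af_1(x)$. $S(X)$ is the set of conditional subsets living on $1$ (non-empty subsets of $X_1$ closed under gluing). $\mathbf{R}$ is the conditional real numbers, a conditionally ordered field (constructed from conditionally Cauchy sequences of conditional rationals). A conditional $\mathbf{R}$-vector space is a conditional set $X$ with conditional functions $+:X\times X\to X$ and $\cdot:\mathbf R\times X\to X$ making $X_1$ a classical $\mathbf{R}_1$-module. $Y\in S(X)$ is a conditional subspace if $Y+Y\sqsubseteq Y$ and $\lambda Y\sqsubseteq Y$ for all $\lambda\in\mathbf R$. A conditional function $f$ is conditionally linear if $f(\lambda x+y)=\lambda f(x)+f(y)$; $k$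 is conditionally convex if $k(\lambda x+(1-\lambda)y)\leqslant\lambda k(x)+(1-\lambda)k(y)$ for all $x,y$ and $\lambda\in\mathbf R$ with $0\leqslant\lambda\leqslant1$. *)

(* Defs.v *)
From HB Require Import structures.
From mathcomp Require Import all_boot all_order all_algebra.
From mathcomp Require Import generic_quotient boolp classical_sets.
From mathcomp Require Import ring lra.
Set Implicit Arguments.
Unset Strict Implicit.
Unset Printing Implicit Defensive.
Import Order.Theory GRing.Theory Num.Theory.
Local Open Scope order_scope.

(* 0 and 1 of the Boolean algebra are \bot and \top. A conditional element x of
   a conditional set X is an element of X_1 = X \top, and "a x" is
   cond_restr a x; "for all x in X" ranges over X_1. *)

HB.mixin Record isCompleteBool d (A : Type) of Order.CTBDistrLattice d A := {
  cba_sup_subproof : forall S : set A, (supremums S !=set0)%classic;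
  cba_bot_neq_top : (\bot : A) != \top }.

#[short(type="cbaType")]
HB.structure Definition CompleteBool d :=
  { A of isCompleteBool d A & Order.CTBDistrLattice d A }.

Definition csup d (A : cbaType d) (S : set A) : A := xget \bot (supremums S).

(* The family a_ belongs to p(a). The index type I is arbitrary and some of the
   a_ i may be \bot. *)
Definition is_part d (A : cbaType d) (I : Type) (a : A) (a_ : I -> A) : Prop :=
  (forall i j, i <> j -> a_ i `&` a_ j = \bot) /\ csup (range a_) = a.

Section CompleteBoolTheory.
Context {d : Order.disp_t} {A : cbaType d}.
Implicit Types (a b c : A) (S : set A).

Lemma csup_supremums S : supremums S (csup S).
Proof. by rewrite /csup; case: xgetP => // H; case: (cba_sup_subproof S) => x /H. Qed.

Lemma csup_ub S x : S x -> x <= csup S.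
Proof. by move=> Sx; have [H _] := csup_supremums S; apply: H. Qed.

Lemma csup_le S y : (forall x, S x -> x <= y) -> csup S <= y.
Proof. by move=> Sy; have [_ H] := csup_supremums S; apply: H. Qed.

Lemma csup_hit S c : c != \bot -> c <= csup S ->
  exists2 s, S s & c `&` s != \bot.
Proof.
move=> c0 cS; apply: contrapT => H; move/negP: c0; apply.
have cC : c <= ~` c.
  apply: le_trans cS _; apply: csup_le => x Sx.
  rewrite -disj_leC meetC; apply/negPn/negP => cx; apply: H.
  by exists x.
by rewrite -lex0 -(meetxC c) lexI lexx.
Qed.

(* Inequalities are checked on a dense set of non-zero conditions. *)
Lemma le_dense a b :
  (forall c, c != \bot -> c <= a -> exists2 c', c' != \bot & (c' <= c) && (c' <= b)) ->
  a <= b.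
Proof.
move=> H; apply/negPn/negP => nab.
have c0 : a `&` ~` b != \bot by move: nab; rewrite disj_leC complK.
have [c' /negP c'0 /andP[]] := H _ c0 (leIl _ _).
rewrite lexI => /andP[_ c'b] c'b'; apply: c'0.
by rewrite -lex0 -(meetxC b) lexI c'b' c'b.
Qed.

Lemma part_hit (I : Type) a (p : I -> A) c : is_part a p -> c != \bot -> c <= a ->
  exists i c', [/\ c' != \bot, c' <= c & c' <= p i].
Proof.
move=> [_ <-] c0 /(csup_hit c0)[_ [i _ <-]] ci.
by exists i, (c `&` p i); rewrite ci leIl leIr.
Qed.

Lemma part_le (I : Type) a (p : I -> A) i : is_part a p -> p i <= a.
Proof. by move=> [_ <-]; apply: csup_ub; exists i. Qed.

Lemma part_uniq (I : Type) a (p : I -> A) c i j : is_part a p -> c != \bot ->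
  c <= p i -> c <= p j -> i = j.
Proof.
move=> [dis _] /negP c0 ci cj; apply: contrapT => /dis ij; apply: c0.
by rewrite -lex0 -ij lexI ci.
Qed.

Lemma is_partI (I : Type) a (p : I -> A) :
  (forall c i j, c != \bot -> c <= p i -> c <= p j -> i = j) ->
  (forall i, p i <= a) ->
  (forall c, c != \bot -> c <= a ->
     exists i c', [/\ c' != \bot, c' <= c & c' <= p i]) ->
  is_part a p.
Proof.
move=> uni pa hit; split.
  move=> i j ij; apply/eqP/negPn/negP => c0; apply: ij.
  by apply: (uni _ _ _ c0); rewrite ?leIl ?leIr.
apply/le_anti/andP; split; first by apply: csup_le => _ [i _ <-].
apply: le_dense => c c0 /(hit _ c0)[i [c' [c'0 c'c c'i]]].
by exists c' => //; rewrite c'c (le_trans c'i) //; apply: csup_ub; exists i.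
Qed.

End CompleteBoolTheory.

Record condSet d (A : cbaType d) := CondSet {
  cond_car :> A -> Type;
  cond_restr : forall a, cond_car \top -> cond_car a;
  cond_surj : forall a (y : cond_car a), exists x, cond_restr a x = y;
  cond_bot : exists x : cond_car \bot, forall y, y = x;
  cond_top : forall x, cond_restr \top x = x;
  cond_consistent : forall a b, b <= a -> forall x y,
    cond_restr a x = cond_restr a y -> cond_restr b x = cond_restr b y;
  cond_stable : forall (I : Type) (a_ : I -> A) (x_ : I -> cond_car \top),
    is_part \top a_ ->
    exists! x, forall i, cond_restr (a_ i) x = cond_restr (a_ i) (x_ i) }.

Record condFun d (A : cbaType d) (X Y : condSet A) := CondFun {
  cond_fun : forall a, X a -> Y a;
  cond_funE : forall a (x : X \top),
    cond_fun (cond_restr a x) = cond_restr a (cond_fun x) }.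
Arguments cond_fun {d A X Y} _ a _.

Definition cond_fun1 d (A : cbaType d) (X Y : condSet A) (f : condFun X Y) :
  X \top -> Y \top := cond_fun f \top.
Coercion cond_fun1 : condFun >-> Funclass.

Section CondProd.
Context {d : Order.disp_t} {A : cbaType d} (X Y : condSet A).

Definition cprod_car (a : A) : Type := (X a * Y a)%type.
Definition cprod_restr a (z : cprod_car \top) : cprod_car a := (cond_restr a z.1, cond_restr a z.2).

Lemma cprod_surj a (y : cprod_car a) : exists x, cprod_restr a x = y.
Proof.
case: y => y1 y2; have [x1 <-] := cond_surj y1; have [x2 <-] := cond_surj y2.
by exists (x1, x2).
Qed.

Lemma cprod_bot : exists x : cprod_car \bot, forall y, y = x.
Proof.
have [x xP] := cond_bot X; have [y yP] := cond_bot Y.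
by exists (x, y) => -[u v]; rewrite (xP u) (yP v).
Qed.

Lemma cprod_top x : cprod_restr \top x = x.
Proof. by case: x => x y; rewrite /cprod_restr !cond_top. Qed.

Lemma cprod_consistent a b : b <= a -> forall x y,
  cprod_restr a x = cprod_restr a y -> cprod_restr b x = cprod_restr b y.
Proof.
move=> ba [x1 x2] [y1 y2] [/(cond_consistent ba) e1 /(cond_consistent ba) e2].
by rewrite /cprod_restr /= e1 e2.
Qed.

Lemma cprod_stable (I : Type) (a_ : I -> A) (x_ : I -> cprod_car \top) : is_part \top a_ ->
  exists! x, forall i, cprod_restr (a_ i) x = cprod_restr (a_ i) (x_ i).
Proof.
move=> ap; have [x [xP xU]] := cond_stable (fun i => (x_ i).1) ap.
have [y [yP yU]] := cond_stable (fun i => (x_ i).2) ap.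
exists (x, y); split=> [i|[u v] uv]; first by rewrite /cprod_restr xP yP.
by congr (_, _); [apply: xU|apply: yU] => i; case: (uv i).
Qed.

Definition cprod : condSet A :=
  CondSet cprod_surj cprod_bot cprod_top cprod_consistent cprod_stable.

End CondProd.

Section CondFunOps.
Context {d : Order.disp_t} {A : cbaType d}.

Lemma cond_comp_subproof (X Y Z : condSet A) (g : condFun Y Z) (f : condFun X Y) a x :
  cond_fun g a (cond_fun f a (cond_restr a x)) =
  cond_restr a (cond_fun g \top (cond_fun f \top x)).
Proof. by rewrite !cond_funE. Qed.
Definition cond_comp (X Y Z : condSet A) (g : condFun Y Z) (f : condFun X Y) :
  condFun X Z :=
  @CondFun _ _ X Z (fun a x => cond_fun g a (cond_fun f a x)) (cond_comp_subproof g f).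

Lemma cond_pair_subproof (X Y Z : condSet A) (f : condFun X Y) (g : condFun X Z) a x :
  (cond_fun f a (cond_restr a x), cond_fun g a (cond_restr a x)) =
  cond_restr (c := cprod Y Z) a (cond_fun f \top x, cond_fun g \top x).
Proof. by rewrite !cond_funE. Qed.
Definition cond_pair (X Y Z : condSet A) (f : condFun X Y) (g : condFun X Z) :
  condFun X (cprod Y Z) :=
  @CondFun _ _ X (cprod Y Z) (fun a x => (cond_fun f a x, cond_fun g a x))
    (cond_pair_subproof f g).

Lemma cond_cst_subproof (X Y : condSet A) (y : Y \top) a (x : X \top) :
  cond_restr a y = cond_restr a (cond_restr \top y).
Proof. by rewrite cond_top. Qed.
Definition cond_cst (X Y : condSet A) (y : Y \top) : condFun X Y :=
  @CondFun _ _ X Y (fun a _ => cond_restr a y) (cond_cst_subproof y).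

End CondFunOps.

Record condSub d (A : cbaType d) (X : condSet A) := CondSub {
  csub_set :> set (X \top);
  csub_neq0 : (csub_set !=set0)%classic;
  csub_glue : forall (I : Type) (a_ : I -> A) (y_ : I -> X \top) (x : X \top),
    is_part \top a_ -> (forall i, csub_set (y_ i)) ->
    (forall i, cond_restr (a_ i) x = cond_restr (a_ i) (y_ i)) -> csub_set x }.

Section CondSub.
Context {d : Order.disp_t} {A : cbaType d} {X : condSet A} (Y : condSub X).

Definition csub_car (a : A) : Type := {x : X a | (cond_restr a @` Y)%classic x}.

Lemma csub_carP (z : csub_car \top) : csub_set Y (sval z).
Proof. by case: z => /= _ [y Yy <-]; rewrite cond_top. Qed.

Lemma csub_restr_subproof a (z : csub_car \top) :
  (cond_restr a @` Y)%classic (cond_restr a (sval z)).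
Proof. by exists (sval z) => //; apply: csub_carP. Qed.

Definition csub_restr a (z : csub_car \top) : csub_car a :=
  exist _ (cond_restr a (sval z)) (csub_restr_subproof a z).

Lemma csub_elt_subproof (x : X \top) : csub_set Y x -> (cond_restr \top @` Y)%classic x.
Proof. by move=> Yx; exists x => //; rewrite cond_top. Qed.

Definition csub_elt (x : X \top) (Yx : csub_set Y x) : csub_car \top :=
  exist _ x (csub_elt_subproof Yx).

Lemma csub_eq a (x y : csub_car a) : sval x = sval y -> x = y.
Proof. exact: eq_sig_hprop (fun _ => @Prop_irrelevance _) _ _. Qed.

Lemma csub_surj a (y : csub_car a) : exists x, csub_restr a x = y.
Proof. by case: (svalP y) => x Yx xy; exists (csub_elt Yx); apply: csub_eq. Qed.

Lemma csub_bot : exists x : csub_car \bot, forall y, y = x.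
Proof.
have [x Yx] := csub_neq0 Y; exists (csub_restr \bot (csub_elt Yx)) => y.
have [z zP] := cond_bot X.
by apply: csub_eq; rewrite (zP (sval y)) (zP (sval (csub_restr _ _))).
Qed.

Lemma csub_top x : csub_restr \top x = x.
Proof. by apply: csub_eq; rewrite /= cond_top. Qed.

Lemma csub_consistent a b : b <= a -> forall x y,
  csub_restr a x = csub_restr a y -> csub_restr b x = csub_restr b y.
Proof.
move=> ba x y [] e; apply: csub_eq => /=; exact: cond_consistent ba _ _ e.
Qed.

Lemma csub_stable (I : Type) (a_ : I -> A) (x_ : I -> csub_car \top) :
  is_part \top a_ ->
  exists! x, forall i, csub_restr (a_ i) x = csub_restr (a_ i) (x_ i).
Proof.
move=> ap; have [x [xP xU]] := cond_stable (fun i => sval (x_ i)) ap.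
have Yx : csub_set Y x by apply: (csub_glue ap _ xP) => i; apply: csub_carP.
exists (csub_elt Yx); split=> [i|y yP]; first by apply: csub_eq; apply: xP.
by apply: csub_eq; apply: xU => i; case: (yP i).
Qed.

(* Y as a conditional set in its own right: Y_a is the image of Y_1 in X_a. *)
Definition csub : condSet A :=
  CondSet csub_surj csub_bot csub_top csub_consistent csub_stable.

End CondSub.

(* An element sum_i a_i e_i of E on a is encoded by p(e) = sup {a_i | e_i = e},
   so that two families representing the same element become equal. *)

Section Generated.
Context {d : Order.disp_t} {A : cbaType d}.
Implicit Types (E F G : Type) (a c : A).

Definition gen_car E a : Type := {p : E -> A | is_part a p}.

Lemma gen_eq E a (p q : gen_car E a) :
  (forall c, c != \bot -> c <= a ->
     exists e c', [/\ c' != \bot, c' <= c, c' <= sval p e & c' <= sval q e]) ->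
  p = q.
Proof.
case: p q => [p pP] [q qP] /= H; apply: eq_sig_hprop => [?|]; first exact: Prop_irrelevance.
apply: funext => e /=; apply/le_anti/andP; split; apply: le_dense => c c0 ce.
  have [|f [c' [c'0 c'c c'p c'q]]] := H c c0; first exact: le_trans ce (part_le _ pP).
  exists c' => //; rewrite c'c.
  by rewrite (part_uniq pP c'0 (le_trans c'c ce) c'p).
have [|f [c' [c'0 c'c c'p c'q]]] := H c c0; first exact: le_trans ce (part_le _ qP).
exists c' => //; rewrite c'c.
by rewrite (part_uniq qP c'0 (le_trans c'c ce) c'q).
Qed.

Lemma gen_restr_subproof E a (p : gen_car E \top) :
  is_part a (fun e => a `&` sval p e).
Proof.
case: p => p pP /=; apply: is_partI.
- move=> c i j c0; rewrite !lexI => /andP[_ ci] /andP[_ cj].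
  exact: part_uniq pP c0 ci cj.
- by move=> i; rewrite leIl.
- move=> c c0 ca; have [i [c' [? c'c ?]]] := part_hit pP c0 (lex1 c).
  by exists i, c'; split=> //; rewrite lexI (le_trans c'c ca).
Qed.

Definition gen_restr E a (p : gen_car E \top) : gen_car E a :=
  exist _ (fun e => a `&` sval p e) (gen_restr_subproof a p).

Lemma gen_glue_subproof E (I : Type) (a_ : I -> A) a (p_ : I -> gen_car E a) :
  is_part \top a_ ->
  is_part a (fun e => csup (range (fun i => a_ i `&` sval (p_ i) e))).
Proof.
move=> aP.
have key c e i : c <= a_ i -> c <= sval (p_ i) e ->
    c <= csup (range (fun i => a_ i `&` sval (p_ i) e)).
  move=> ci ce; apply: (@le_trans _ _ (a_ i `&` sval (p_ i) e)).
    by rewrite lexI ci.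
  by apply: csup_ub; exists i.
apply: is_partI.
- move=> c e f c0 ce cf.
  have [i [c1 [c10 c1c c1i]]] := part_hit aP c0 (lex1 c).
  have h g : c <= csup (range (fun i => a_ i `&` sval (p_ i) g)) ->
      forall c1, c1 != \bot -> c1 <= c -> c1 <= a_ i ->
      exists c2, [/\ c2 != \bot, c2 <= c1 & c2 <= sval (p_ i) g].
    move=> cg c3 c30 c3c c3i.
    have [_ [j _ <-] c3j] := csup_hit c30 (le_trans c3c cg).
    exists (c3 `&` (a_ j `&` sval (p_ j) g)); split=> //; first exact: leIl.
    have <- : j = i.
      apply: (part_uniq aP c3j).
        by apply: le_trans (leIr _ _) (leIl _ _).
      by apply: le_trans (leIl _ _) _.
    by apply: le_trans (leIr _ _) (leIr _ _).
  have [c2 [c20 c21 c2e]] := h _ ce _ c10 c1c c1i.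
  have [c3 [c30 c32 c3f]] := h _ cf _ c20 (le_trans c21 c1c) (le_trans c21 c1i).
  exact: part_uniq (svalP (p_ i)) c30 (le_trans c32 c2e) c3f.
- move=> e; apply: csup_le => _ [i _ <-].
  exact: le_trans (leIr _ _) (part_le _ (svalP (p_ i))).
- move=> c c0 ca; have [i [c1 [c10 c1c c1i]]] := part_hit aP c0 (lex1 c).
  have [e [c2 [c20 c21 c2e]]] := part_hit (svalP (p_ i)) c10 (le_trans c1c ca).
  exists e, c2; split=> //; first exact: le_trans c21 c1c.
  exact: key (le_trans c21 c1i) c2e.
Qed.

Definition gen_glue E (I : Type) (a_ : I -> A) a (p_ : I -> gen_car E a)
    (aP : is_part \top a_) : gen_car E a :=
  exist _ _ (gen_glue_subproof p_ aP).

Lemma gen_glue_val E (I : Type) (a_ : I -> A) a (p_ : I -> gen_car E a)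
    (aP : is_part \top a_) c i e :
  c <= a_ i -> c <= sval (p_ i) e -> c <= sval (gen_glue p_ aP) e.
Proof.
move=> ci ce /=; apply: (@le_trans _ _ (a_ i `&` sval (p_ i) e)).
  by rewrite lexI ci.
by apply: csup_ub; exists i.
Qed.

Lemma gen_cst_subproof E (e0 : E) a :
  is_part a (fun e => csup [set b | e = e0 /\ b = a]%classic).
Proof.
have E0 e c : c != \bot -> c <= csup [set b | e = e0 /\ b = a]%classic -> e = e0.
  by move=> c0 /(csup_hit c0)[b [-> _] _].
apply: is_partI.
- by move=> c i j c0 /(E0 _ _ c0) -> /(E0 _ _ c0) ->.
- by move=> i; apply: csup_le => _ [_ ->].
- by move=> c c0 ca; exists e0, c; split=> //; apply: le_trans ca _; apply: csup_ub.
Qed.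

Definition gen_cst E (e0 : E) a : gen_car E a := exist _ _ (gen_cst_subproof e0 a).

Lemma gen_cst_val E (e0 : E) a c : c <= a -> c <= sval (gen_cst e0 a) e0.
Proof. by move=> ca; apply: le_trans ca _; apply: csup_ub. Qed.

Section GenSet.
Context (E : Type) (e0 : E).

Lemma gen_surj a (y : gen_car E a) : exists x, gen_restr a x = y.
Proof.
have bP : is_part \top (fun b : bool => if b then a else ~` a).
  apply: is_partI => //.
  - move=> c [] [] // /negP c0 ca cb; case: c0; rewrite -lex0.
      by rewrite -(meetxC a) lexI ca.
    by rewrite -(meetxC a) lexI ca cb.
  - move=> c c0 _; have [ca|ca] := eqVneq (c `&` a) \bot.
      by exists false, c; split=> //; rewrite -disj_leC ca.
    by exists true, (c `&` a); rewrite ca leIl leIr.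
have yP : is_part \top (fun e => (if `[< e = e0 >] then ~` a else \bot) `|` sval y e).
  apply: is_partI.
  - move=> c i j c0 ci cj.
    have [b [c1 [c10 c1c c1b]]] := part_hit bP c0 (lex1 c).
    case: b c1b => c1b.
      have h k : c <= (if `[< k = e0 >] then ~` a else \bot) `|` sval y k ->
          c1 <= sval y k.
        move=> /(le_trans c1c); case: asboolP => _; last by rewrite join0x.
        by rewrite disjoint_lexUr //; apply/eqP; rewrite disj_leC complK.
      exact: part_uniq (svalP y) c10 (h _ ci) (h _ cj).
    have h k : c <= (if `[< k = e0 >] then ~` a else \bot) `|` sval y k -> k = e0.
      move=> /(le_trans c1c); case: asboolP => // _; rewrite join0x => c1y.
      have c1a := le_trans c1y (part_le _ (svalP y)).
      by move/negP: c10; case; rewrite -lex0 -(meetxC a) lexI c1a.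
    by rewrite (h _ ci) (h _ cj).
  - by move=> i; rewrite lex1.
  - move=> c c0 _; have [b [c1 [c10 c1c c1b]]] := part_hit bP c0 (lex1 c).
    case: b c1b => c1b.
      have [e [c2 [c20 c21 c2e]]] := part_hit (svalP y) c10 c1b.
      by exists e, c2; split=> //; [exact: le_trans c21 c1c|exact: lexUr].
    by exists e0, c1; split=> //; rewrite asboolT //; exact: lexUl.
exists (exist _ _ yP); apply: gen_eq => c c0 ca.
have [e [c1 [c10 c1c c1e]]] := part_hit (svalP y) c0 ca.
by exists e, c1; split=> //=; rewrite lexI (le_trans c1c ca) lexUr.
Qed.

Lemma gen_bot : exists x : gen_car E \bot, forall y, y = x.
Proof.
by exists (gen_cst e0 \bot) => y; apply: gen_eq => c /negP c0; rewrite lex0 => /c0.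
Qed.

Lemma gen_top (x : gen_car E \top) : gen_restr \top x = x.
Proof.
apply: gen_eq => c c0 ca; have [e [c1 [c10 c1c c1e]]] := part_hit (svalP x) c0 ca.
by exists e, c1; split=> //=; rewrite meet1x.
Qed.

Lemma gen_consistent a b : b <= a -> forall x y : gen_car E \top,
  gen_restr a x = gen_restr a y -> gen_restr b x = gen_restr b y.
Proof.
move=> ba x y /(congr1 (@sval _ _))/= e; apply: gen_eq => c c0 cb.
have [f [c1 [c10 c1c c1e]]] := part_hit (svalP x) c0 (lex1 c).
have c1b := le_trans c1c cb; have c1a := le_trans c1b ba.
exists f, c1; split=> //=; first by rewrite lexI c1b.
have : c1 <= a `&` sval x f by rewrite lexI c1a.
by rewrite (congr1 (@^~ f) e) !lexI c1b => /andP[].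
Qed.

Lemma gen_stable (I : Type) (a_ : I -> A) (x_ : I -> gen_car E \top) :
  is_part \top a_ ->
  exists! x, forall i, gen_restr (a_ i) x = gen_restr (a_ i) (x_ i).
Proof.
move=> aP; exists (gen_glue x_ aP); split=> [i|y yP].
  apply: gen_eq => c c0 ci.
  have [e [c1 [c10 c1c c1e]]] := part_hit (svalP (x_ i)) c0 (lex1 c).
  have c1i := le_trans c1c ci.
  by exists e, c1; rewrite !lexI c1i c1e (gen_glue_val aP c1i c1e).
apply: gen_eq => c c0 _; have [i [c1 [c10 c1c c1i]]] := part_hit aP c0 (lex1 c).
have [e [c2 [c20 c21 c2e]]] := part_hit (svalP (x_ i)) c10 (lex1 c1).
have c2i := le_trans c21 c1i.
exists e, c2; split=> //; [exact: le_trans c21 c1c|exact: gen_glue_val c2i c2e|].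
have : c2 <= a_ i `&` sval (x_ i) e by rewrite lexI c2i.
by have /(congr1 (fun z => sval z e))/= <- := yP i; rewrite lexI => /andP[].
Qed.

Definition gen : condSet A :=
  CondSet gen_surj gen_bot gen_top gen_consistent gen_stable.

End GenSet.

(* The extension of a relation, of a function and of pairing to generated sets:
   sum a_i e_i and sum b_j f_j are related iff e_i and f_j are related whenever
   a_i `&` b_j != 0, and h (sum a_i e_i) = sum a_i h(e_i). *)
Definition gen_rel E F (r : E -> F -> Prop) a (p : gen_car E a) (q : gen_car F a) :=
  forall e f, sval p e `&` sval q f != \bot -> r e f.

Lemma gen_relP E F (r : E -> F -> Prop) a (p : gen_car E a) (q : gen_car F a) c e f :
  gen_rel r p q -> c != \bot -> c <= sval p e -> c <= sval q f -> r e f.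
Proof.
move=> H c0 ce cf; apply: H; apply: contra c0 => /eqP H.
by rewrite -lex0 -H lexI ce.
Qed.

Lemma gen_relI E F (r : E -> F -> Prop) a (p : gen_car E a) (q : gen_car F a) :
  (forall c, c != \bot -> c <= a -> exists e f c',
     [/\ c' != \bot, c' <= c, c' <= sval p e, c' <= sval q f & r e f]) ->
  gen_rel r p q.
Proof.
move=> H e f c0.
have [|e' [f' [c' [c'0 c'c c'e c'f]]]] := H _ c0.
  exact: le_trans (leIl _ _) (part_le _ (svalP p)).
rewrite (part_uniq (svalP p) c'0 (le_trans c'c (leIl _ _)) c'e).
by rewrite (part_uniq (svalP q) c'0 (le_trans c'c (leIr _ _)) c'f).
Qed.

Lemma gen_map_subproof1 E F (h : E -> F) a (p : gen_car E a) :
  is_part a (fun f => csup [set sval p e | e in [set e | h e = f]]%classic).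
Proof.
have key f c : c != \bot -> c <= csup [set sval p e | e in [set e | h e = f]]%classic ->
    exists e c', [/\ c' != \bot, c' <= c, c' <= sval p e & h e = f].
  move=> c0 /(csup_hit c0)[_ [e he <-] ce].
  by exists e, (c `&` sval p e); rewrite leIl leIr.
apply: is_partI.
- move=> c f g c0 /[dup] cf /(key _ _ c0)[e [c1 [c10 c1c c1e <-]]] cg.
  have [e' [c2 [c20 c21 c2e <-]]] := key _ _ c10 (le_trans c1c cg).
  by rewrite (part_uniq (svalP p) c20 (le_trans c21 c1e) c2e).
- by move=> f; apply: csup_le => _ [e _ <-]; exact: part_le (svalP p).
- move=> c c0 ca; have [e [c' [? ? c'e]]] := part_hit (svalP p) c0 ca.
  by exists (h e), c'; split=> //; apply: le_trans c'e _; apply: csup_ub; exists e.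
Qed.

Definition gen_map1 E F (h : E -> F) a (p : gen_car E a) : gen_car F a :=
  exist _ _ (gen_map_subproof1 h p).

Lemma gen_map_val E F (h : E -> F) a (p : gen_car E a) c e :
  c <= sval p e -> c <= sval (gen_map1 h p) (h e).
Proof. by move=> ce; apply: le_trans ce _; apply: csup_ub; exists e. Qed.

Lemma gen_pair_subproof1 E F a (p : gen_car E a) (q : gen_car F a) :
  is_part a (fun ef => sval p ef.1 `&` sval q ef.2).
Proof.
apply: is_partI.
- move=> c [e f] [e' f'] c0; rewrite !lexI /= => /andP[ce cf] /andP[ce' cf'].
  by rewrite (part_uniq (svalP p) c0 ce ce') (part_uniq (svalP q) c0 cf cf').
- by move=> [e f]; apply: le_trans (leIl _ _) (part_le _ (svalP p)).
- move=> c c0 ca; have [e [c1 [c10 c1c c1e]]] := part_hit (svalP p) c0 ca.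
  have [f [c2 [c20 c21 c2f]]] := part_hit (svalP q) c10 (le_trans c1c ca).
  exists (e, f), c2; split=> //; first exact: le_trans c21 c1c.
  by rewrite lexI /= (le_trans c21 c1e).
Qed.

Definition gen_pair1 E F a (p : gen_car E a) (q : gen_car F a) : gen_car (E * F) a :=
  exist _ _ (gen_pair_subproof1 p q).

Lemma gen_pair_val E F a (p : gen_car E a) (q : gen_car F a) c e f :
  c <= sval p e -> c <= sval q f -> c <= sval (gen_pair1 p q) (e, f).
Proof. by move=> ce cf; rewrite lexI ce. Qed.

Lemma gen_restr_val E a (p : gen_car E \top) c e :
  c <= a -> c <= sval p e -> c <= sval (gen_restr a p) e.
Proof. by move=> ca ce; rewrite lexI ca. Qed.

Lemma gen_op_subproof E F G (e0 : E) (f0 : F) (h : E -> F -> G) a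
    (p : cprod (gen e0) (gen f0) \top) :
  gen_map1 (fun ef => h ef.1 ef.2)
    (gen_pair1 (cond_restr a p).1 (cond_restr a p).2) =
  gen_restr a (gen_map1 (fun ef => h ef.1 ef.2) (gen_pair1 p.1 p.2)).
Proof.
apply: gen_eq => c c0 ca.
have [e [c1 [c10 c1c c1e]]] := part_hit (svalP p.1) c0 (lex1 c).
have [f [c2 [c20 c21 c2f]]] := part_hit (svalP p.2) c10 (lex1 c1).
have c2c := le_trans c21 c1c; have c2e := le_trans c21 c1e.
have c2a := le_trans c2c ca.
have H := gen_pair_val (gen_restr_val c2a c2e) (gen_restr_val c2a c2f).
have H' := gen_pair_val c2e c2f.
exists (h e f), c2; split=> //; first exact: gen_map_val H.
by apply: (gen_restr_val c2a); apply: gen_map_val H'.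
Qed.

Definition gen_op E F G (e0 : E) (f0 : F) (g0 : G) (h : E -> F -> G) :
    condFun (cprod (gen e0) (gen f0)) (gen g0) :=
  @CondFun _ _ (cprod (gen e0) (gen f0)) (gen g0)
    (fun a p => gen_map1 (fun ef => h ef.1 ef.2) (gen_pair1 p.1 p.2))
    (gen_op_subproof h).

Lemma gen_op_val E F G (e0 : E) (f0 : F) (g0 : G) (h : E -> F -> G)
    (p : gen e0 \top) (q : gen f0 \top) c e f :
  c <= sval p e -> c <= sval q f -> c <= sval (gen_op e0 f0 g0 h (p, q)) (h e f).
Proof.
by move=> ce cf; exact: (gen_map_val (fun ef => h ef.1 ef.2) (gen_pair_val ce cf)).
Qed.

End Generated.

Section CondNatRat.
Context {d : Order.disp_t} (A : cbaType d).

Definition cnat : condSet A := gen 0%N.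
Definition crat : condSet A := gen (0%R : rat).

Definition cnat_le a (m n : cnat a) : Prop := gen_rel leq m n.
Definition crat_le a (x y : crat a) : Prop := gen_rel (fun p q : rat => p <= q) x y.
Definition crat_lt a (x y : crat a) : Prop := gen_rel (fun p q : rat => p < q) x y.
Definition crat_cst (q : rat) : crat \top := gen_cst q \top.
Definition crat_op (h : rat -> rat -> rat) : condFun (cprod crat crat) crat :=
  gen_op 0%R 0%R 0%R h.
Definition crat_add := crat_op (fun p q => p + q)%R.
Definition crat_mul := crat_op (fun p q => p * q)%R.
Definition crat_dist := crat_op (fun p q => `|p - q|)%R.

End CondNatRat.
Arguments cnat_le {d A a} m n.
Arguments crat_le {d A a} x y.
Arguments crat_lt {d A a} x y.
Arguments crat_cst {d A} q.
Arguments crat_op {d A} h.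
Arguments crat_add {d A}.
Arguments crat_mul {d A}.
Arguments crat_dist {d A}.

Definition is_cauchy d (A : cbaType d) (s : condFun (cnat A) (crat A)) : Prop :=
  forall eps : crat A \top, crat_lt (crat_cst 0%R) eps ->
  exists n0 : cnat A \top, forall m n : cnat A \top,
    cnat_le n0 m -> cnat_le n0 n -> crat_le (crat_dist (s m, s n)) eps.

(* s - t converges conditionally to 0 on a. Every element of crat A a and of
   cnat A a lifts to \top, so eps and n may range over elements living on \top. *)
Definition null_diff d (A : cbaType d) (a : A) (s t : condFun (cnat A) (crat A)) : Prop :=
  forall eps : crat A \top, crat_lt (crat_cst 0%R) eps ->
  exists n0 : cnat A \top, forall n : cnat A \top, cnat_le n0 n ->
    crat_le (cond_restr a (crat_dist (s n, t n))) (cond_restr a eps).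

Definition seq_op d (A : cbaType d) (h : condFun (cprod (crat A) (crat A)) (crat A))
    (s t : condFun (cnat A) (crat A)) : condFun (cnat A) (crat A) :=
  cond_comp h (cond_pair s t).
Definition seq_cst d (A : cbaType d) (q : rat) : condFun (cnat A) (crat A) :=
  cond_cst (cnat A) (Y := crat A) (crat_cst q).
Arguments seq_cst {d A} q.

(* Hit a partition p by the current condition c, keeping all "c <= _" facts. *)
Ltac cond_hit P e :=
  match goal with c0 : is_true (?c != \bot) |- _ =>
    let c' := fresh "c" in let c'0 := fresh "c" in let c'c := fresh "c" in
    let H := fresh "H" in
    destruct (part_hit P c0 (lex1 c)) as [e [c' [c'0 c'c H]]];
    repeat match goal with K : is_true (c <= _) |- _ =>
      apply (le_trans c'c) in K end;
    clear c'c; clear c0; try clear c; move: c'0 => c0; rename c' into c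
  end.

Section SeqTheory.
Context {d : Order.disp_t} {A : cbaType d}.
Implicit Types (a c : A) (eps : crat A \top) (m n : cnat A \top).
Implicit Types (s t : condFun (cnat A) (crat A)).

Lemma rel_restrI E F (r : E -> F -> Prop) a (p : gen_car E \top) (q : gen_car F \top) :
  (forall c, c != \bot -> c <= a -> exists e f c',
     [/\ c' != \bot, c' <= c, c' <= sval p e, c' <= sval q f & r e f]) ->
  gen_rel r (gen_restr a p) (gen_restr a q).
Proof.
move=> H; apply: gen_relI => c c0 ca.
have [e [f [c' [c'0 c'c c'e c'f ref]]]] := H c c0 ca.
exists e, f, c'; split=> //; apply: gen_restr_val => //; exact: le_trans c'c ca.
Qed.

Lemma rel_restrP E F (r : E -> F -> Prop) a (p : gen_car E \top) (q : gen_car F \top)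
    c e f : gen_rel r (gen_restr a p) (gen_restr a q) ->
  c != \bot -> c <= a -> c <= sval p e -> c <= sval q f -> r e f.
Proof. by move=> H c0 ca ce cf; apply: (gen_relP H c0); apply: gen_restr_val. Qed.

Lemma cst_val (E : Type) (e : E) c : c <= sval (gen_cst e (\top : A)) e.
Proof. exact: gen_cst_val (lex1 c). Qed.

Lemma pos_val eps c e : crat_lt (crat_cst 0%R) eps -> c != \bot -> c <= sval eps e ->
  (0 < e)%R.
Proof. by move=> H c0; apply: (gen_relP H c0); apply: cst_val. Qed.

Definition cmax m n : cnat A \top := gen_op 0%N 0%N 0%N maxn (m, n).

Lemma cmax_val m n c i j : c <= sval m i -> c <= sval n j -> c <= sval (cmax m n) (maxn i j).
Proof. exact: gen_op_val. Qed.

Lemma below c : c != \bot -> exists c', c' != \bot /\ c' <= c.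
Proof. by move=> c0; exists c. Qed.

Lemma cmax_l m n k : cnat_le (cmax m n) k -> cnat_le m k.
Proof.
move=> H; apply: gen_relI => c1 /below[c [c0 cc]] _.
cond_hit (svalP m) i; cond_hit (svalP n) j; cond_hit (svalP k) l.
exists i, l, c; split=> //.
have := gen_relP H c0 (cmax_val H0 H1) H2.
by rewrite geq_max => /andP[].
Qed.

Lemma cmax_r m n k : cnat_le (cmax m n) k -> cnat_le n k.
Proof.
move=> H; apply: gen_relI => c1 /below[c [c0 cc]] _.
cond_hit (svalP m) i; cond_hit (svalP n) j; cond_hit (svalP k) l.
exists j, l, c; split=> //.
have := gen_relP H c0 (cmax_val H0 H1) H2.
by rewrite geq_max => /andP[].
Qed.

Lemma le_cmax_r m n : cnat_le n (cmax m n).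
Proof.
apply: gen_relI => c1 /below[c [c0 cc]] _.
cond_hit (svalP m) i; cond_hit (svalP n) j.
exists j, (maxn i j), c; split=> //; [exact: cmax_val|exact: leq_maxr].
Qed.

Lemma cnat_le_refl n : cnat_le n n.
Proof.
apply: gen_relI => c1 /below[c [c0 cc]] _; cond_hit (svalP n) i.
by exists i, i, c; split.
Qed.

Definition crat_map (h : rat -> rat) eps : crat A \top := gen_map1 h eps.

Lemma crat_map_val h eps c e : c <= sval eps e -> c <= sval (crat_map h eps) (h e).
Proof. exact: gen_map_val. Qed.

Lemma half_pos eps : crat_lt (crat_cst 0%R) eps ->
  crat_lt (crat_cst 0%R) (crat_map (fun x => x / 2)%R eps).
Proof.
move=> H; apply: gen_relI => c1 /below[c [c0 cc]] _; cond_hit (svalP eps) e.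
exists 0%R, (e / 2)%R, c; split=> //; [exact: cst_val|exact: crat_map_val|].
by have := pos_val H c0 H0; lra.
Qed.

Lemma seq_local s m n c k x : c <= sval m k -> c <= sval n k ->
  c <= sval (s m) x -> c <= sval (s n) x.
Proof.
move=> cm cn cs.
have mn : cond_restr (c := cnat A) c m = cond_restr c n.
  apply: gen_eq => c1 /below[c2 [c20 c21]] c1c.
  have c2c := le_trans c21 c1c.
  by exists k, c2; split=> //; apply: gen_restr_val; rewrite ?(le_trans c2c).
have : cond_restr c (s m) = cond_restr c (s n) by rewrite -!cond_funE mn.
move=> /(congr1 (fun z => sval z x))/= e.
have : c <= c `&` sval (s m) x by rewrite lexI lexx.
by rewrite [X in _ <= X -> _]e lexI => /andP[].
Qed.

Lemma dist_val (x y : crat A \top) c p q : c <= sval x p -> c <= sval y q ->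
  c <= sval (crat_dist (x, y)) `|p - q|%R.
Proof. exact: (gen_op_val 0%R (fun p q : rat => `|p - q|%R)). Qed.

Lemma seq_op_val h s t n c x y : c <= sval (s n) x -> c <= sval (t n) y ->
  c <= sval (seq_op (crat_op h) s t n) (h x y).
Proof. exact: gen_op_val. Qed.

Lemma null_diff_eq a s t : (forall n, s n = t n) -> null_diff a s t.
Proof.
move=> st eps He; exists (gen_cst 0%N \top) => n _; rewrite st.
apply: rel_restrI => c1 /below[c [c0 cc]] _.
cond_hit (svalP eps) e; cond_hit (svalP (t n)) x.
exists `|x - x|%R, e, c; split=> //; first exact: dist_val.
by rewrite subrr normr0 ltW // (pos_val He c0 H).
Qed.

Lemma null_diff_refl a s : null_diff a s s.
Proof. exact: null_diff_eq. Qed.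

Lemma null_diff_sym a s t : null_diff a s t -> null_diff a t s.
Proof.
move=> st eps /st[n0 H]; exists n0 => n /H Hn.
apply: rel_restrI => c1 /below[c [c0 cc]] c1a.
cond_hit (svalP eps) e; cond_hit (svalP (s n)) x; cond_hit (svalP (t n)) y.
exists `|y - x|%R, e, c; split=> //; first exact: dist_val.
rewrite distrC; exact: (rel_restrP Hn c0 (le_trans cc c1a) (dist_val H1 H2)).
Qed.

Lemma null_diff_trans a s t u : null_diff a s t -> null_diff a t u -> null_diff a s u.
Proof.
move=> st tu eps He; have He2 := half_pos He.
have [n1 H1] := st _ He2; have [n2 H2] := tu _ He2.
exists (cmax n1 n2) => n nn; have L1 := H1 _ (cmax_l nn); have L2 := H2 _ (cmax_r nn).
apply: rel_restrI => c1 /below[c [c0 cc]] c1a.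
cond_hit (svalP eps) e; cond_hit (svalP (s n)) x; cond_hit (svalP (t n)) y.
cond_hit (svalP (u n)) z.
exists `|x - z|%R, e, c; split=> //; first exact: dist_val.
have ca := le_trans cc c1a; have ce := crat_map_val (fun x => x / 2)%R H.
have := rel_restrP L1 c0 ca (dist_val H0 H3) ce.
have := rel_restrP L2 c0 ca (dist_val H3 H4) ce.
by have := ler_distD y x z; lra.
Qed.

Lemma null_diff_le a b s t : b <= a -> null_diff a s t -> null_diff b s t.
Proof.
move=> ba st eps /st[n0 H]; exists n0 => n /H Hn.
apply: rel_restrI => c1 /below[c [c0 cc]] c1b.
cond_hit (svalP eps) e; cond_hit (svalP (s n)) x; cond_hit (svalP (t n)) y.
exists `|x - y|%R, e, c; split=> //; first exact: dist_val.
exact: (rel_restrP Hn c0 (le_trans (le_trans cc c1b) ba) (dist_val H1 H2)).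
Qed.

Lemma null_diff_bot s t : null_diff \bot s t.
Proof.
move=> eps He; exists (gen_cst 0%N \top) => n _.
by apply: rel_restrI => c1 /negP c0; rewrite lex0 => /c0.
Qed.

Section Glue.
Context (I : Type) (a_ : I -> A) (aP : is_part \top a_).
Context (t_ : I -> condFun (cnat A) (crat A)).

Lemma seq_glue_subproof a (n : cnat A \top) :
  gen_glue (fun i => cond_fun (t_ i) a (cond_restr a n)) aP =
  cond_restr (c := crat A) a (gen_glue (fun i => cond_fun (t_ i) \top n) aP).
Proof.
apply: gen_eq => c1 /below[c [c0 cc]] c1a.
cond_hit aP i; cond_hit (svalP (t_ i n)) x.
have ca := le_trans cc c1a.
exists x, c; split=> //.
  by apply: (gen_glue_val aP H); rewrite cond_funE; apply: gen_restr_val.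
by apply: gen_restr_val => //; apply: (gen_glue_val aP H).
Qed.

Definition seq_glue : condFun (cnat A) (crat A) :=
  @CondFun _ _ (cnat A) (crat A)
    (fun a (n : cnat A a) => gen_glue (fun i => cond_fun (t_ i) a n) aP) seq_glue_subproof.

Lemma seq_glue_val i n c x : c <= a_ i -> c <= sval (t_ i n) x ->
  c <= sval (seq_glue n) x.
Proof. by move=> ci cx; apply: (gen_glue_val aP ci). Qed.

Lemma seq_glue_null i : null_diff (a_ i) seq_glue (t_ i).
Proof.
move=> eps He; exists (gen_cst 0%N \top) => n _.
apply: rel_restrI => c1 /below[c [c0 cc]] c1a.
cond_hit (svalP eps) e; cond_hit (svalP (t_ i n)) x.
exists `|x - x|%R, e, c; split=> //.
  by apply: dist_val => //; apply: seq_glue_val H0; apply: le_trans cc c1a.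
by rewrite subrr normr0 ltW // (pos_val He c0 H).
Qed.

Lemma glue_cmax (n_ : I -> cnat A \top) m i c k : cnat_le (gen_glue n_ aP) m ->
  c != \bot -> c <= a_ i -> c <= sval m k ->
  exists c', [/\ c' != \bot, c' <= c & c' <= sval (cmax m (n_ i)) k].
Proof.
move=> H /below[c1 [c0 cc]] ci cm.
have := le_trans cc ci; have := le_trans cc cm => {ci cm} cm ci.
rename c into c'; rename c1 into c; cond_hit (svalP (n_ i)) j.
exists c; split=> //.
have jk : (j <= k)%N by apply: (gen_relP H c0 _ cm); apply: (gen_glue_val aP ci).
by have := cmax_val cm H0; rewrite (maxn_idPl jk).
Qed.

Lemma seq_glue_cauchy : (forall i, is_cauchy (t_ i)) -> is_cauchy seq_glue.
Proof.
move=> tC eps He.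
pose n_ i : cnat A \top := sval (cid (tC i eps He)).
have nP i : forall m n : cnat A \top, cnat_le (n_ i) m -> cnat_le (n_ i) n ->
    crat_le (crat_dist (t_ i m, t_ i n)) eps := svalP (cid (tC i eps He)).
exists (gen_glue n_ aP) => m n nm nn.
apply: gen_relI => c1 /below[c [c0 cc]] _.
cond_hit aP i; cond_hit (svalP m) k; cond_hit (svalP n) l; cond_hit (svalP eps) e.
have [c2 [c20 c2c cm]] := glue_cmax nm c0 H H0.
have [c3 [c30 c32 cn]] := glue_cmax nn c20 (le_trans c2c H) (le_trans c2c H1).
have cm' := le_trans c32 cm; have c3c := le_trans c32 c2c.
move: (le_trans c3c H) (le_trans c3c H0) (le_trans c3c H1) (le_trans c3c H2) (le_trans c3c cc).
move=> {cc c0 H H0 H1 H2 c2c c20 c32 c3c cm} h h0 h1 h2 cc.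
clear c c2; rename c3 into c; rename c30 into c0.
cond_hit (svalP (t_ i (cmax m (n_ i)))) x; cond_hit (svalP (t_ i (cmax n (n_ i)))) y.
exists `|x - y|%R, e, c; split=> //.
  apply: dist_val; apply: (seq_glue_val h).
    exact: seq_local cm' h0 H.
  exact: seq_local cn h1 H0.
have := nP i (cmax m (n_ i)) (cmax n (n_ i)) (@le_cmax_r _ _) (@le_cmax_r _ _).
by move=> L; apply: (gen_relP L c0 (dist_val H H0)).
Qed.

Lemma null_diff_glue s t : (forall i, null_diff (a_ i) s t) -> null_diff \top s t.
Proof.
move=> st eps He.
pose n_ i : cnat A \top := sval (cid (st i eps He)).
have nP i := svalP (cid (st i eps He)).
exists (gen_glue n_ aP) => m nm.
apply: rel_restrI => c1 /below[c [c0 cc]] _.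
cond_hit aP i; cond_hit (svalP m) k; cond_hit (svalP eps) e.
have [c2 [c20 c2c cm]] := glue_cmax nm c0 H H0.
move: (le_trans c2c H) (le_trans c2c H0) (le_trans c2c H1) (le_trans c2c cc).
move=> {cc c0 H H0 H1 c2c} h h0 h1 cc.
clear c; rename c2 into c; rename c20 into c0.
cond_hit (svalP (s (cmax m (n_ i)))) x; cond_hit (svalP (t (cmax m (n_ i)))) y.
exists `|x - y|%R, e, c; split=> //.
  apply: dist_val.
    exact: seq_local cm h0 H.
  exact: seq_local cm h0 H0.
have L := nP i (cmax m (n_ i)) (@le_cmax_r _ _).
exact: (rel_restrP L c0 h (dist_val H H0)).
Qed.

End Glue.

Lemma seq_cst_cauchy q : is_cauchy (seq_cst q : condFun (cnat A) (crat A)).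
Proof.
move=> eps He; exists (gen_cst 0%N \top) => m n _ _.
apply: gen_relI => c1 /below[c [c0 cc]] _; cond_hit (svalP eps) e.
exists `|q - q|%R, e, c; split=> //.
  by apply: dist_val; rewrite /= meet1x; apply: cst_val.
by rewrite subrr normr0 ltW // (pos_val He c0 H).
Qed.

Lemma seq_cst_val q n c : c <= sval (seq_cst q n : crat A \top) q.
Proof. by rewrite /= meet1x; apply: cst_val. Qed.

Lemma lip_cauchy h s t :
  (forall x y x' y', `|h x y - h x' y'| <= `|x - x'| + `|y - y'|)%R ->
  is_cauchy s -> is_cauchy t -> is_cauchy (seq_op (crat_op h) s t).
Proof.
move=> hL sC tC eps He; have He2 := half_pos He.
have [n1 H1] := sC _ He2; have [n2 H2] := tC _ He2.
exists (cmax n1 n2) => m n nm nn.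
have L1 := H1 _ _ (cmax_l nm) (cmax_l nn); have L2 := H2 _ _ (cmax_r nm) (cmax_r nn).
apply: gen_relI => c1 /below[c [c0 cc]] _.
cond_hit (svalP eps) e; cond_hit (svalP (s m)) x; cond_hit (svalP (t m)) y.
cond_hit (svalP (s n)) x'; cond_hit (svalP (t n)) y'.
exists `|h x y - h x' y'|%R, e, c; split=> //.
  by apply: dist_val; apply: seq_op_val.
have ce := crat_map_val (fun x => x / 2)%R H.
have := gen_relP L1 c0 (dist_val H0 H4) ce.
have := gen_relP L2 c0 (dist_val H3 H5) ce.
by have := hL x y x' y'; lra.
Qed.

Lemma lip_null h a s t s' t' :
  (forall x y x' y', `|h x y - h x' y'| <= `|x - x'| + `|y - y'|)%R ->
  null_diff a s s' -> null_diff a t t' ->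
  null_diff a (seq_op (crat_op h) s t) (seq_op (crat_op h) s' t').
Proof.
move=> hL ss tt eps He; have He2 := half_pos He.
have [n1 H1] := ss _ He2; have [n2 H2] := tt _ He2.
exists (cmax n1 n2) => n nn; have L1 := H1 _ (cmax_l nn); have L2 := H2 _ (cmax_r nn).
apply: rel_restrI => c1 /below[c [c0 cc]] c1a.
cond_hit (svalP eps) e; cond_hit (svalP (s n)) x; cond_hit (svalP (t n)) y.
cond_hit (svalP (s' n)) x'; cond_hit (svalP (t' n)) y'.
exists `|h x y - h x' y'|%R, e, c; split=> //.
  by apply: dist_val; apply: seq_op_val.
have ca := le_trans cc c1a; have ce := crat_map_val (fun x => x / 2)%R H.
have := rel_restrP L1 c0 ca (dist_val H0 H4) ce.
have := rel_restrP L2 c0 ca (dist_val H3 H5) ce.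
by have := hL x y x' y'; lra.
Qed.

Definition seq_bound s (M : crat A \top) n0 := forall n, cnat_le n0 n ->
  gen_rel (fun x y : rat => `|x| + 1 <= y)%R (s n) M.

Lemma cauchy_bound s : is_cauchy s -> exists M n0, seq_bound s M n0.
Proof.
move=> sC.
have p1 : crat_lt (crat_cst 0%R) (crat_cst 1%R : crat A \top).
  apply: gen_relI => c c0 _.
  by exists 0%R, 1%R, c; split=> //; apply: cst_val.
have [n0 H] := sC _ p1; exists (crat_map (fun x => `|x| + 2)%R (s n0)), n0 => n nn.
have L := H _ _ nn (@cnat_le_refl n0).
apply: gen_relI => c1 /below[c [c0 cc]] _.
cond_hit (svalP (s n)) x; cond_hit (svalP (s n0)) y.
exists x, (`|y| + 2)%R, c; split=> //; first exact: (crat_map_val (fun x => `|x| + 2)%R).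
have := gen_relP L c0 (dist_val H0 H1) (cst_val _ _).
by have := ler_normD (x - y)%R y; rewrite subrK; lra.
Qed.

Definition mul_delta eps (M N : crat A \top) : crat A \top :=
  crat_op (fun x y => x / y)%R (eps, crat_add (M, N)).

Lemma mul_delta_val eps (M N : crat A \top) c e x y :
  c <= sval eps e -> c <= sval M x -> c <= sval N y ->
  c <= sval (mul_delta eps M N) (e / (x + y))%R.
Proof.
move=> ce cx cy; apply: (gen_op_val 0%R (fun x y : rat => (x / y)%R)) => //.
exact: (gen_op_val 0%R (fun x y : rat => (x + y)%R)).
Qed.

Lemma mul_delta_pos s t eps (M N : crat A \top) m n :
  seq_bound s M m -> seq_bound t N n -> crat_lt (crat_cst 0%R) eps ->
  crat_lt (crat_cst 0%R) (mul_delta eps M N).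
Proof.
move=> sM tN He; have {}sM := sM _ (@cnat_le_refl m); have {}tN := tN _ (@cnat_le_refl n).
apply: gen_relI => c1 /below[c [c0 cc]] _.
cond_hit (svalP eps) e; cond_hit (svalP M) x; cond_hit (svalP N) y.
cond_hit (svalP (s m)) u; cond_hit (svalP (t n)) v.
exists 0%R, (e / (x + y))%R, c; split=> //; [exact: cst_val|exact: mul_delta_val|].
have := gen_relP sM c0 H2 H0; have := gen_relP tN c0 H3 H1.
have := pos_val He c0 H => ? ? ?; apply: divr_gt0 => //.
by have := normr_ge0 u; have := normr_ge0 v; lra.
Qed.

Lemma mul_ineq (e M N x y x' y' : rat) :
  (`|x| + 1 <= M -> `|y'| + 1 <= N ->
  `|x - x'| <= e / (N + M) -> `|y - y'| <= e / (N + M) ->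
  `|x * y - x' * y'| <= e)%R.
Proof.
move=> xM yN xx yy.
have -> : (x * y - x' * y' = x * (y - y') + (x - x') * y')%R by ring.
apply: le_trans (ler_normD _ _) _; rewrite !normrM.
have d0 : (0 <= e / (N + M))%R by apply: (le_trans (normr_ge0 _) xx).
have NM : (N + M != 0)%R.
  by have := normr_ge0 x; have := normr_ge0 y'; move=> *; apply/eqP; lra.
apply: (@le_trans _ _ (M * (e / (N + M)) + (e / (N + M)) * N))%R.
  by have := normr_ge0 x; have := normr_ge0 y'; move=> *; apply: lerD; apply: ler_pM => //; lra.
by rewrite mulrC -mulrDr [(M + N)%R]addrC divfK.
Qed.

Lemma mul_cauchy s t : is_cauchy s -> is_cauchy t ->
  is_cauchy (seq_op crat_mul s t).
Proof.
move=> sC tC eps He.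
have [M [m1 sM]] := cauchy_bound sC; have [N [m2 tN]] := cauchy_bound tC.
have Hd := mul_delta_pos tN sM He.
have [n1 H1] := sC _ Hd; have [n2 H2] := tC _ Hd.
exists (cmax (cmax n1 n2) (cmax m1 m2)) => m n nm nn.
have L1 := H1 _ _ (cmax_l (cmax_l nm)) (cmax_l (cmax_l nn)).
have L2 := H2 _ _ (cmax_r (cmax_l nm)) (cmax_r (cmax_l nn)).
have L3 := sM _ (cmax_l (cmax_r nm)); have L4 := tN _ (cmax_r (cmax_r nn)).
apply: gen_relI => c1 /below[c [c0 cc]] _.
cond_hit (svalP eps) e; cond_hit (svalP (s m)) x; cond_hit (svalP (t m)) y.
cond_hit (svalP (s n)) x'; cond_hit (svalP (t n)) y'.
cond_hit (svalP M) u; cond_hit (svalP N) v.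
exists `|x * y - x' * y'|%R, e, c; split=> //.
  by apply: dist_val; apply: (seq_op_val (fun p q => p * q)%R).
have cd := mul_delta_val H H7 H6.
apply: (mul_ineq (M := u) (N := v)).
- exact: gen_relP L3 c0 H0 H6.
- exact: gen_relP L4 c0 H5 H7.
- exact: gen_relP L1 c0 (dist_val H0 H4) cd.
- exact: gen_relP L2 c0 (dist_val H3 H5) cd.
Qed.

Lemma mul_null a s t s' t' : is_cauchy s -> is_cauchy t' ->
  null_diff a s s' -> null_diff a t t' ->
  null_diff a (seq_op crat_mul s t) (seq_op crat_mul s' t').
Proof.
move=> sC tC ss tt eps He.
have [M [m1 sM]] := cauchy_bound sC; have [N [m2 tN]] := cauchy_bound tC.
have Hd := mul_delta_pos tN sM He.
have [n1 H1] := ss _ Hd; have [n2 H2] := tt _ Hd.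
exists (cmax (cmax n1 n2) (cmax m1 m2)) => n nn.
have L1 := H1 _ (cmax_l (cmax_l nn)).
have L2 := H2 _ (cmax_r (cmax_l nn)).
have L3 := sM _ (cmax_l (cmax_r nn)); have L4 := tN _ (cmax_r (cmax_r nn)).
apply: rel_restrI => c1 /below[c [c0 cc]] c1a.
cond_hit (svalP eps) e; cond_hit (svalP (s n)) x; cond_hit (svalP (t n)) y.
cond_hit (svalP (s' n)) x'; cond_hit (svalP (t' n)) y'.
cond_hit (svalP M) u; cond_hit (svalP N) v.
exists `|x * y - x' * y'|%R, e, c; split=> //.
  by apply: dist_val; apply: (seq_op_val (fun p q => p * q)%R).
have ca := le_trans cc c1a; have cd := mul_delta_val H H7 H6.
apply: (mul_ineq (M := u) (N := v)).
- exact: gen_relP L3 c0 H0 H6.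
- exact: gen_relP L4 c0 H5 H7.
- exact: rel_restrP L1 c0 ca (dist_val H0 H4) cd.
- exact: rel_restrP L2 c0 ca (dist_val H3 H5) cd.
Qed.

End SeqTheory.

Local Open Scope quotient_scope.

Record cauchySeq d (A : cbaType d) := CauchySeq {
  cauchy_fun :> condFun (cnat A) (crat A);
  cauchyP : is_cauchy cauchy_fun }.

HB.instance Definition _ d (A : cbaType d) := gen_eqMixin (cauchySeq A).
HB.instance Definition _ d (A : cbaType d) := gen_choiceMixin (cauchySeq A).

Section CondReals.
Context {d : Order.disp_t} (A : cbaType d).
Implicit Types (a : A) (s t : cauchySeq A).

Definition creal_eqv a : rel (cauchySeq A) := fun s t => `[< null_diff a s t >].

Lemma creal_eqv_refl a : reflexive (creal_eqv a).
Proof. by move=> s; apply/asboolP/null_diff_refl. Qed.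

Lemma creal_eqv_sym a : symmetric (creal_eqv a).
Proof. by move=> s t; apply/asboolP/asboolP; apply: null_diff_sym. Qed.

Lemma creal_eqv_trans a : transitive (creal_eqv a).
Proof. by move=> t s u /asboolP st /asboolP tu; apply/asboolP/(null_diff_trans st). Qed.

Canonical creal_equiv a :=
  EquivRel (creal_eqv a) (@creal_eqv_refl a) (@creal_eqv_sym a) (@creal_eqv_trans a).

(* The set R_a. Since elements living on a are restrictions of elements living on
   1, it is a quotient of the set of sequences living on 1. *)
Definition creal_car a : Type := {eq_quot creal_equiv a}.

Definition creal_pi a (s : cauchySeq A) : creal_car a := \pi_({eq_quot creal_equiv a}) s.
Definition creal_repr a (x : creal_car a) : cauchySeq A := repr (x : {eq_quot creal_equiv a}).

Lemma creal_reprK a (x : creal_car a) : creal_pi a (creal_repr x) = x.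
Proof. exact: reprK. Qed.

Lemma creal_piP a s t : creal_pi a s = creal_pi a t <-> null_diff a s t.
Proof.
split=> [/eqquotP/asboolP //|st].
by apply/eqquotP/asboolP.
Qed.

Lemma creal_repr_null a b s : b <= a -> null_diff b (creal_repr (creal_pi a s)) s.
Proof. by move=> ba; apply: (null_diff_le ba); apply/creal_piP/creal_reprK. Qed.

Definition creal_restr a (x : creal_car \top) : creal_car a := creal_pi a (creal_repr x).

Lemma creal_restr_pi a s : creal_restr a (creal_pi \top s) = creal_pi a s.
Proof. by apply/creal_piP; apply: creal_repr_null; exact: lex1. Qed.

Lemma creal_surj a (y : creal_car a) : exists x, creal_restr a x = y.
Proof. by exists (creal_pi \top (creal_repr y)); rewrite creal_restr_pi creal_reprK. Qed.

Lemma creal_top x : creal_restr \top x = x.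
Proof. exact: creal_reprK. Qed.

Lemma creal_consistent a b : b <= a -> forall x y,
  creal_restr a x = creal_restr a y -> creal_restr b x = creal_restr b y.
Proof. by move=> ba x y /creal_piP H; apply/creal_piP/(null_diff_le ba). Qed.

Lemma creal_stable (I : Type) (a_ : I -> A) (x_ : I -> creal_car \top) :
  is_part \top a_ ->
  exists! x, forall i, creal_restr (a_ i) x = creal_restr (a_ i) (x_ i).
Proof.
move=> aP.
have gC := seq_glue_cauchy aP (fun i => cauchyP (creal_repr (x_ i))).
exists (creal_pi \top (CauchySeq gC)); split=> [i|y yP].
  by rewrite creal_restr_pi; apply/creal_piP/(seq_glue_null aP).
rewrite -(creal_reprK y); apply/creal_piP/(null_diff_glue aP) => i.
have /creal_piP yi := yP i; apply: null_diff_trans (null_diff_sym yi).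
exact: (seq_glue_null aP).
Qed.

Lemma creal_bot : exists x : creal_car \bot, forall y, y = x.
Proof.
exists (creal_pi \bot (CauchySeq (seq_cst_cauchy 0%R))) => y.
by rewrite -(creal_reprK y); apply/creal_piP/null_diff_bot.
Qed.

Definition creal : condSet A :=
  CondSet creal_surj creal_bot creal_top creal_consistent creal_stable.

Definition creal1 : Type := creal_car \top.

Lemma lip_add (x y x' y' : rat) :
  (`|(x + y) - (x' + y')| <= `|x - x'| + `|y - y'|)%R.
Proof.
have -> : (x + y - (x' + y') = (x - x') + (y - y'))%R by ring.
exact: ler_normD.
Qed.

Lemma lip_sub (x y x' y' : rat) :
  (`|(x - y) - (x' - y')| <= `|x - x'| + `|y - y'|)%R.
Proof.
have -> : (x - y - (x' - y') = (x - x') - (y - y'))%R by ring.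
exact: ler_normB.
Qed.

Definition cauchy_cst q : cauchySeq A := CauchySeq (seq_cst_cauchy q).
Definition cauchy_add s t : cauchySeq A :=
  CauchySeq (lip_cauchy lip_add (cauchyP s) (cauchyP t)).
Definition cauchy_sub s t : cauchySeq A :=
  CauchySeq (lip_cauchy lip_sub (cauchyP s) (cauchyP t)).
Definition cauchy_mul s t : cauchySeq A :=
  CauchySeq (mul_cauchy (cauchyP s) (cauchyP t)).

Definition creal_cst q : creal1 := creal_pi \top (cauchy_cst q).
Definition creal_add (x y : creal1) : creal1 :=
  creal_pi \top (cauchy_add (creal_repr x) (creal_repr y)).
Definition creal_opp (x : creal1) : creal1 :=
  creal_pi \top (cauchy_sub (cauchy_cst 0%R) (creal_repr x)).
Definition creal_mul (x y : creal1) : creal1 :=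
  creal_pi \top (cauchy_mul (creal_repr x) (creal_repr y)).

Lemma creal_addE s t :
  creal_add (creal_pi \top s) (creal_pi \top t) = creal_pi \top (cauchy_add s t).
Proof. by apply/creal_piP; apply: (lip_null lip_add); apply: creal_repr_null. Qed.

Lemma creal_oppE s :
  creal_opp (creal_pi \top s) = creal_pi \top (cauchy_sub (cauchy_cst 0%R) s).
Proof.
apply/creal_piP; apply: (lip_null lip_sub); last exact: creal_repr_null.
exact: null_diff_refl.
Qed.

Lemma creal_mulE s t :
  creal_mul (creal_pi \top s) (creal_pi \top t) = creal_pi \top (cauchy_mul s t).
Proof.
apply/creal_piP; apply: mul_null; try exact: cauchyP; exact: creal_repr_null.
Qed.

Lemma cauchy_ext s t : (forall n : cnat A \top, s n = t n) ->
  creal_pi \top s = creal_pi \top t.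
Proof. by move=> st; apply/creal_piP/null_diff_eq. Qed.

Lemma cadd_val s t (n : cnat A \top) c x y : c <= sval (s n) x -> c <= sval (t n) y ->
  c <= sval (cauchy_add s t n) (x + y)%R.
Proof. exact: (seq_op_val (fun x y : rat => x + y)%R). Qed.

Lemma csub_val s t (n : cnat A \top) c x y : c <= sval (s n) x -> c <= sval (t n) y ->
  c <= sval (cauchy_sub s t n) (x - y)%R.
Proof. exact: (seq_op_val (fun x y : rat => x - y)%R). Qed.

Lemma cmul_val s t (n : cnat A \top) c x y : c <= sval (s n) x -> c <= sval (t n) y ->
  c <= sval (cauchy_mul s t n) (x * y)%R.
Proof. exact: (seq_op_val (fun x y : rat => x * y)%R). Qed.

Lemma ccst_val q (n : cnat A \top) c : c <= sval (cauchy_cst q n) q.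
Proof. exact: seq_cst_val. Qed.

Lemma creal_addA : associative creal_add.
Proof.
move=> x y z; rewrite -(creal_reprK x) -(creal_reprK y) -(creal_reprK z) !creal_addE.
apply: cauchy_ext => n; apply: gen_eq => c1 /below[c [c0 cc]] _.
cond_hit (svalP (creal_repr x n)) p; cond_hit (svalP (creal_repr y n)) q.
cond_hit (svalP (creal_repr z n)) r.
exists (p + (q + r))%R, c; split=> //; first by do 2?apply: cadd_val => //.
by rewrite addrA; do 2?apply: cadd_val => //.
Qed.

Lemma creal_addC : commutative creal_add.
Proof.
move=> x y; rewrite -(creal_reprK x) -(creal_reprK y) !creal_addE.
apply: cauchy_ext => n; apply: gen_eq => c1 /below[c [c0 cc]] _.
cond_hit (svalP (creal_repr x n)) p; cond_hit (svalP (creal_repr y n)) q.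
exists (p + q)%R, c; split=> //; first exact: cadd_val.
by rewrite addrC; apply: cadd_val.
Qed.

Lemma creal_add0 : left_id (creal_cst 0%R) creal_add.
Proof.
move=> x; rewrite -(creal_reprK x) creal_addE.
apply: cauchy_ext => n; apply: gen_eq => c1 /below[c [c0 cc]] _.
cond_hit (svalP (creal_repr x n)) p.
exists p, c; split=> //.
by rewrite -{1}(add0r p); apply: cadd_val => //; apply: ccst_val.
Qed.

Lemma creal_addN : left_inverse (creal_cst 0%R) creal_opp creal_add.
Proof.
move=> x; rewrite -(creal_reprK x) creal_oppE creal_addE.
apply: cauchy_ext => n; apply: gen_eq => c1 /below[c [c0 cc]] _.
cond_hit (svalP (creal_repr x n)) p.
exists 0%R, c; split=> //; last exact: ccst_val.
by have := cadd_val (csub_val (ccst_val 0%R n c) H) H; rewrite sub0r addNr.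
Qed.

Lemma creal_mulA : associative creal_mul.
Proof.
move=> x y z; rewrite -(creal_reprK x) -(creal_reprK y) -(creal_reprK z) !creal_mulE.
apply: cauchy_ext => n; apply: gen_eq => c1 /below[c [c0 cc]] _.
cond_hit (svalP (creal_repr x n)) p; cond_hit (svalP (creal_repr y n)) q.
cond_hit (svalP (creal_repr z n)) r.
exists (p * (q * r))%R, c; split=> //; first by do 2?apply: cmul_val => //.
by rewrite mulrA; do 2?apply: cmul_val => //.
Qed.

Lemma creal_mulC : commutative creal_mul.
Proof.
move=> x y; rewrite -(creal_reprK x) -(creal_reprK y) !creal_mulE.
apply: cauchy_ext => n; apply: gen_eq => c1 /below[c [c0 cc]] _.
cond_hit (svalP (creal_repr x n)) p; cond_hit (svalP (creal_repr y n)) q.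
exists (p * q)%R, c; split=> //; first exact: cmul_val.
by rewrite mulrC; apply: cmul_val.
Qed.

Lemma creal_mul1 : left_id (creal_cst 1%R) creal_mul.
Proof.
move=> x; rewrite -(creal_reprK x) creal_mulE.
apply: cauchy_ext => n; apply: gen_eq => c1 /below[c [c0 cc]] _.
cond_hit (svalP (creal_repr x n)) p.
exists p, c; split=> //.
by rewrite -{1}(mul1r p); apply: cmul_val => //; apply: ccst_val.
Qed.

Lemma creal_mulD : left_distributive creal_mul creal_add.
Proof.
move=> x y z; rewrite -(creal_reprK x) -(creal_reprK y) -(creal_reprK z).
rewrite !(creal_addE, creal_mulE).
apply: cauchy_ext => n; apply: gen_eq => c1 /below[c [c0 cc]] _.
cond_hit (svalP (creal_repr x n)) p; cond_hit (svalP (creal_repr y n)) q.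
cond_hit (svalP (creal_repr z n)) r.
exists ((p + q) * r)%R, c; split=> //.
  by apply: cmul_val => //; apply: cadd_val.
by rewrite mulrDl; apply: cadd_val; apply: cmul_val.
Qed.

Lemma creal_1neq0 : creal_cst 1%R <> creal_cst 0%R.
Proof.
move=> /creal_piP H.
have p1 : crat_lt (crat_cst 0%R) (crat_cst 2^-1%R : crat A \top).
  apply: gen_relI => c c0 _.
  by exists 0%R, 2^-1%R, c; split=> //; apply: cst_val.
have [n0 /(_ _ (@cnat_le_refl _ _ n0)) L] := H _ p1.
have c0 : (\top : A) != \bot by rewrite eq_sym cba_bot_neq_top.
have := rel_restrP L c0 (lexx _) (dist_val (ccst_val 1%R n0 _) (ccst_val 0%R n0 _)).
by move=> /(_ _ (cst_val _ _)); rewrite subr0 normr1.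
Qed.

Definition cauchy_le s t : Prop :=
  forall eps : crat A \top, crat_lt (crat_cst 0%R) eps ->
  exists n0 : cnat A \top, forall n : cnat A \top, cnat_le n0 n ->
    crat_le (s n) (crat_add (t n, eps)).

Definition creal_le (x y : creal1) : Prop := cauchy_le (creal_repr x) (creal_repr y).

Lemma cauchy_le_compat s t s' t' : null_diff \top s s' -> null_diff \top t t' ->
  cauchy_le s t -> cauchy_le s' t'.
Proof.
move=> ss tt st eps He; have He2 := half_pos He; have He4 := half_pos He2.
have [n1 H1] := ss _ He4; have [n2 H2] := tt _ He4; have [n3 H3] := st _ He2.
exists (cmax (cmax n1 n2) n3) => n nn.
have L1 := H1 _ (cmax_l (cmax_l nn)).
have L2 := H2 _ (cmax_r (cmax_l nn)).
have L3 := H3 _ (cmax_r nn).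
apply: gen_relI => c1 /below[c [c0 cc]] _.
cond_hit (svalP eps) e; cond_hit (svalP (s n)) x; cond_hit (svalP (t n)) y.
cond_hit (svalP (s' n)) x'; cond_hit (svalP (t' n)) y'.
exists x', (y' + e)%R, c; split=> //.
  exact: (gen_op_val 0%R (fun x y : rat => x + y)%R).
have ce := crat_map_val (fun x => x / 2)%R H.
have ce4 := crat_map_val (fun x => x / 2)%R ce.
have := rel_restrP L1 c0 (lex1 c) (dist_val H0 H5) ce4.
have := rel_restrP L2 c0 (lex1 c) (dist_val H4 H6) ce4.
have := gen_relP L3 c0 H0 (gen_op_val 0%R (fun x y : rat => x + y)%R H4 ce).
by rewrite !ler_norml => ? /andP[? ?] /andP[? ?]; lra.
Qed.

Lemma creal_leE s t : creal_le (creal_pi \top s) (creal_pi \top t) <-> cauchy_le s t.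
Proof.
have K u := @creal_repr_null \top \top u (lexx _).
split=> H; first exact: cauchy_le_compat (K s) (K t) H.
exact: cauchy_le_compat (null_diff_sym (K s)) (null_diff_sym (K t)) H.
Qed.

End CondReals.

HB.instance Definition _ d (A : cbaType d) := Choice.on (creal1 A).
HB.instance Definition _ d (A : cbaType d) :=
  GRing.isZmodule.Build (creal1 A) (@creal_addA d A) (@creal_addC d A)
    (@creal_add0 d A) (@creal_addN d A).

Lemma creal_one_neq0 d (A : cbaType d) : creal_cst A 1%R != (0%R : creal1 A).
Proof. exact/eqP/creal_1neq0. Qed.
HB.instance Definition _ d (A : cbaType d) :=
  GRing.Zmodule_isComNzRing.Build (creal1 A) (@creal_mulA d A) (@creal_mulC d A)
    (@creal_mul1 d A) (@creal_mulD d A) (@creal_one_neq0 d A).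

Local Open Scope ring_scope.

(* cvect_class is the structure of R_1-module on X_1; the last two axioms say that
   its operations are those of the conditional functions + and . at level 1. *)
Record condVect d (A : cbaType d) := CondVect {
  cvect_set :> condSet A;
  cvect_add : condFun (cprod cvect_set cvect_set) cvect_set;
  cvect_scale : condFun (cprod (creal A) cvect_set) cvect_set;
  cvect_class : GRing.Lmodule.axioms_ (creal1 A) (cvect_set \top);
  cvect_addE : forall x y : GRing.Lmodule.Pack cvect_class,
    cvect_add (x, y) = x + y;
  cvect_scaleE : forall (l : creal1 A) (x : GRing.Lmodule.Pack cvect_class),
    cvect_scale (l, x) = l *: x }.

Definition cvect1 d (A : cbaType d) (X : condVect A) : lmodType (creal1 A) :=
  GRing.Lmodule.Pack (cvect_class X).

Definition cond_subspace d (A : cbaType d) (X : condVect A) (Y : condSub X) : Prop :=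
  (forall x y : cvect1 X, csub_set Y x -> csub_set Y y -> csub_set Y (x + y)) /\
  (forall (l : creal1 A) (x : cvect1 X), csub_set Y x -> csub_set Y (l *: x)).

Definition cond_linear d (A : cbaType d) (X : condVect A) (f : condFun X (creal A)) :
    Prop :=
  forall (l : creal1 A) (x y : cvect1 X),
    f (l *: x + y) = l * (f x : creal1 A) + (f y : creal1 A).

Definition cond_convex d (A : cbaType d) (X : condVect A) (k : condFun X (creal A)) :
    Prop :=
  forall (l : creal1 A) (x y : cvect1 X),
    creal_le 0 l -> creal_le l 1 ->
    creal_le (k (l *: x + (1 - l) *: y))
             (l * (k x : creal1 A) + (1 - l) * (k y : creal1 A)).

Section SubVect.
Context {d : Order.disp_t} {A : cbaType d} {X : condVect A} (Y : condSub X).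
Context (hY : cond_subspace Y).

Lemma csub_add_im a (x y : X a) : (cond_restr a @` Y)%classic x ->
  (cond_restr a @` Y)%classic y ->
  (cond_restr a @` Y)%classic (cond_fun (cvect_add X) a (x, y)).
Proof.
move=> [x1 Yx <-] [y1 Yy <-]; exists ((x1 : cvect1 X) + y1); first exact: hY.1.
by rewrite -(cvect_addE (c := X)); symmetry; apply: (cond_funE (cvect_add X) a (x1, y1)).
Qed.

Lemma csub_scale_im a (l : creal A a) (x : X a) : (cond_restr a @` Y)%classic x ->
  (cond_restr a @` Y)%classic (cond_fun (cvect_scale X) a (l, x)).
Proof.
have [l1 <-] := cond_surj l; move=> [x1 Yx <-].
exists ((l1 : creal1 A) *: (x1 : cvect1 X)); first exact: hY.2.
by rewrite -(cvect_scaleE (c := X)); symmetry; apply: (cond_funE (cvect_scale X) a (l1, x1)).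
Qed.

Lemma csub_add_subproof a (z : cprod (csub Y) (csub Y) \top) :
  exist _ _ (csub_add_im (svalP (cond_restr a z).1) (svalP (cond_restr a z).2)) =
  cond_restr (c := csub Y) a (exist _ _ (csub_add_im (svalP z.1) (svalP z.2))).
Proof.
by apply: csub_eq => /=; apply: (cond_funE (cvect_add X) a (sval z.1, sval z.2)).
Qed.

Definition csub_add : condFun (cprod (csub Y) (csub Y)) (csub Y) :=
  @CondFun _ _ (cprod (csub Y) (csub Y)) (csub Y)
    (fun a z => exist _ _ (csub_add_im (svalP z.1) (svalP z.2))) csub_add_subproof.

Lemma csub_scale_subproof a (z : cprod (creal A) (csub Y) \top) :
  exist _ _ (csub_scale_im (cond_restr a z).1 (svalP (cond_restr a z).2)) =
  cond_restr (c := csub Y) a (exist _ _ (csub_scale_im z.1 (svalP z.2))).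
Proof.
by apply: csub_eq => /=; apply: (cond_funE (cvect_scale X) a (z.1, sval z.2)).
Qed.

Definition csub_scale : condFun (cprod (creal A) (csub Y)) (csub Y) :=
  @CondFun _ _ (cprod (creal A) (csub Y)) (csub Y)
    (fun a z => exist _ _ (csub_scale_im z.1 (svalP z.2))) csub_scale_subproof.

(* The unused hY makes the instances below, which depend on it, inferable. *)
Definition csub1 : Type := let _ := hY in csub Y \top.

Lemma csub0_subproof : csub_set Y (0 : cvect1 X).
Proof.
have [x Yx] := csub_neq0 Y; rewrite -(scale0r (x : cvect1 X)); exact: hY.2.
Qed.

Lemma csubN_subproof (x : csub1) : csub_set Y (- (sval x : cvect1 X)).
Proof. by rewrite -scaleN1r; apply: hY.2; apply: csub_carP. Qed.

Definition csub0 : csub1 := csub_elt csub0_subproof.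
Definition csub_opp (x : csub1) : csub1 := csub_elt (csubN_subproof x).
Definition csub_add1 (x y : csub1) : csub1 := csub_add (x, y).
Definition csub_scale1 (l : creal1 A) (x : csub1) : csub1 := csub_scale (l, x).

Lemma csub_add1E x y : sval (csub_add1 x y) = (sval x : cvect1 X) + (sval y : cvect1 X).
Proof. exact: (cvect_addE (c := X)). Qed.

Lemma csub_scale1E l x : sval (csub_scale1 l x) = l *: (sval x : cvect1 X).
Proof. exact: (cvect_scaleE (c := X)). Qed.

Lemma csub_addA : associative csub_add1.
Proof. by move=> x y z; apply: csub_eq; rewrite !csub_add1E; exact: (@addrA (cvect1 X)). Qed.

Lemma csub_addC : commutative csub_add1.
Proof. by move=> x y; apply: csub_eq; rewrite !csub_add1E; exact: (@addrC (cvect1 X)). Qed.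

Lemma csub_add0 : left_id csub0 csub_add1.
Proof. by move=> x; apply: csub_eq; rewrite csub_add1E; exact: (@add0r (cvect1 X)). Qed.

Lemma csub_addN : left_inverse csub0 csub_opp csub_add1.
Proof. by move=> x; apply: csub_eq; rewrite csub_add1E; exact: (@addNr (cvect1 X)). Qed.

HB.instance Definition _ := gen_eqMixin csub1.
HB.instance Definition _ := gen_choiceMixin csub1.
HB.instance Definition _ :=
  GRing.isZmodule.Build csub1 csub_addA csub_addC csub_add0 csub_addN.

Lemma csub_scaleA a b v : csub_scale1 a (csub_scale1 b v) = csub_scale1 (a * b) v.
Proof. by apply: csub_eq; rewrite !csub_scale1E; exact: (@scalerA _ (cvect1 X)). Qed.

Lemma csub_scale1r : left_id 1 csub_scale1.
Proof. by move=> v; apply: csub_eq; rewrite csub_scale1E; exact: (@scale1r _ (cvect1 X)). Qed.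

Lemma csub_scaleDr : right_distributive csub_scale1 +%R.
Proof.
move=> a u v; apply: csub_eq; rewrite csub_scale1E !csub_add1E !csub_scale1E.
exact: (@scalerDr _ (cvect1 X)).
Qed.

Lemma csub_scaleDl v : {morph csub_scale1^~ v : a b / a + b}.
Proof.
move=> a b; apply: csub_eq; rewrite csub_add1E !csub_scale1E.
exact: (@scalerDl _ (cvect1 X)).
Qed.

HB.instance Definition _ :=
  GRing.Zmodule_isLmodule.Build (creal1 A) csub1 csub_scaleA csub_scale1r
    csub_scaleDr csub_scaleDl.

Definition csub_vect : condVect A :=
  @CondVect d A (csub Y) csub_add csub_scale
    (GRing.Lmodule.class (csub1 : lmodType (creal1 A)))
    (fun _ _ => erefl) (fun _ _ => erefl).

End SubVect.

(* Main.v *)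
Require Import Defs.
From mathcomp Require Import all_boot all_order all_algebra.
From mathcomp Require Import boolp classical_sets.
From mathcomp Require Import ring lra.

(** A conditional real is handled through its rational approximations on small
    conditions, which exist on a dense set of conditions; conversely every dense and
    coherent family of rational approximations defines a conditional real. This
    yields suprema of bounded sets and inverses of elements bounded below by a
    positive rational.

    The extension is the graph of a function obtained by Zorn's lemma among the
    R_1-submodules G of X_1 x R_1 such that a <= k x for (x, a) in G. Such a G is
    functional because the multiples of a non-zero conditional real are not bounded
    above. To adjoin x0, take for its value the supremum r of the
    (a - k (z - m x0)) / m, where (z, a) is in G and m is bounded below by a positive
    rational. A coefficient l of x0 need not be positive, negative or zero, but on a
    dense set of conditions it agrees with an l' for which l' or - l' is bounded
    below by a positive rational or l' = 0, and this is enough because k is local.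
    Linear maps on X_1 are local, so the total map obtained is a conditional function. *)

Set Implicit Arguments.
Unset Strict Implicit.
Unset Printing Implicit Defensive.
Import Order.Theory GRing.Theory Num.Theory.
Local Open Scope order_scope.
Local Open Scope ring_scope.

(** * Rational approximations of conditional reals *)

Section Approximation.
Context {d : Order.disp_t} {A : cbaType d}.
Implicit Types (a b c : A) (p q e del : rat).
Implicit Types (s t : condFun (cnat A) (crat A)) (x y z : creal1 A).

Local Notation crestr := (@cond_restr _ _ (creal A)).

(* On [c], [|s - p| <= e] in the limit; the slack [del] makes this independent of the
   Cauchy sequence chosen to represent a real. *)
Definition seq_approx c s p e : Prop :=
  forall del, 0 < del -> exists n0 : cnat A \top, forall n : cnat A \top,
    cnat_le n0 n -> forall c' u, c' != \bot -> (c' <= c)%O ->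
    (c' <= sval (s n) u)%O -> `|u - p| <= e + del.

Definition approx c x p e : Prop := seq_approx c (creal_repr x) p e.

Lemma cst_pos e : 0 < e -> crat_lt (crat_cst 0) (crat_cst e : crat A \top).
Proof.
by move=> e0; apply: gen_relI => c c0 _; exists 0, e, c; split=> //; apply: cst_val.
Qed.

(** Half of the slack [del] absorbs the null difference, so passing to an equivalent sequence does
    not enlarge the error [e]. *)
Lemma seq_approx_null c s t p e :
  null_diff c s t -> seq_approx c s p e -> seq_approx c t p e.
Proof.
move=> st sp del del0.
have [n1 H1] := st _ (cst_pos (divr_gt0 del0 (@ltr0Sn rat 1))).
have [n2 H2] := sp _ (divr_gt0 del0 (@ltr0Sn rat 1)).
exists (cmax n1 n2) => n nn c' u c0 c'c cu.
have L1 := H1 _ (cmax_l nn); have L2 := H2 _ (cmax_r nn).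
rename c into b; rename c' into c; cond_hit (svalP (s n)) v.
have := rel_restrP L1 c0 c'c (dist_val H cu) (cst_val _ _).
have := L2 _ _ c0 c'c H.
rewrite !ler_norml => /andP[? ?] /andP[? ?]; apply/andP; split; lra.
Qed.

Lemma approx_pi c (s : cauchySeq A) p e :
  approx c (creal_pi \top s) p e <-> seq_approx c s p e.
Proof.
have H : null_diff c (creal_repr (creal_pi \top s)) s by apply: creal_repr_null; exact: lex1.
by split; apply: seq_approx_null => //; apply: null_diff_sym.
Qed.

Lemma approx_restr c x y p e :
  crestr c x = crestr c y ->
  approx c x p e -> approx c y p e.
Proof. by move=> /creal_piP; apply: seq_approx_null. Qed.

Lemma approx_sub c c' x p e : (c' <= c)%O -> approx c x p e -> approx c' x p e.
Proof.
move=> c'c H del /H[n0 {}H]; exists n0 => n /H{}H b u b0 bc' bu.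
exact: H b0 (le_trans bc' c'c) bu.
Qed.

(** One term beyond the Cauchy index already approximates the limit, with the Cauchy tolerance as
    error. This is where the approximations of a given real come from. *)
Lemma seq_approx_value s (eps : crat A \top) (n0 : cnat A \top) :
  (forall m n : cnat A \top, cnat_le n0 m -> cnat_le n0 n ->
    crat_le (crat_dist (s m, s n)) eps) ->
  forall (n : cnat A \top) c p e, cnat_le n0 n -> (c <= sval (s n) p)%O ->
    (c <= sval eps e)%O -> seq_approx c s p e.
Proof.
move=> H n c p e nn cp ce del del0; exists n0 => m mm c' u c'0 c'c cu.
have := gen_relP (H m n mm nn) c'0 (dist_val cu (le_trans c'c cp)) (le_trans c'c ce).
by move=> /le_trans; apply; rewrite lerDl ltW.
Qed.

Lemma approx_exists x e c : 0 < e -> c != \bot ->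
  exists c' p, [/\ c' != \bot, (c' <= c)%O & approx c' x p e].
Proof.
move=> /cst_pos/(cauchyP (creal_repr x))[n0 H] c0.
have [p [c' [c'0 c'c cp]]] := part_hit (svalP (creal_repr x n0)) c0 (lex1 c).
exists c', p; split=> //.
exact: (seq_approx_value H (@cnat_le_refl _ _ n0) cp (cst_val _ _)).
Qed.

Lemma le_epsilon_rat p q : (forall del, 0 < del -> p <= q + del) -> p <= q.
Proof. by move=> H; rewrite leNgt; apply/negP => qp; have := H ((p - q) / 2); lra. Qed.

Lemma approx_dist c x p q e e' : c != \bot -> approx c x p e -> approx c x q e' ->
  `|p - q| <= e + e'.
Proof.
move=> c0 xp xq; apply: le_epsilon_rat => del del0.
have [n1 H1] := xp _ (divr_gt0 del0 (@ltr0Sn rat 1)).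
have [n2 H2] := xq _ (divr_gt0 del0 (@ltr0Sn rat 1)).
(* Both approximations are compared with a single term whose index passes both thresholds, on a
   smaller condition where this term is a plain rational [u]. *)
have [u [c' [c'0 c'c cu]]] := part_hit (svalP (creal_repr x (cmax n1 n2))) c0 (lex1 c).
have := H1 _ (cmax_l (@cnat_le_refl _ _ _)) _ _ c'0 c'c cu.
have := H2 _ (cmax_r (@cnat_le_refl _ _ _)) _ _ c'0 c'c cu.
by rewrite !ler_norml => /andP[? ?] /andP[? ?]; apply/andP; split; lra.
Qed.

Lemma approx_ge0 c x p e : c != \bot -> approx c x p e -> 0 <= e.
Proof. by move=> c0 xp; have := approx_dist c0 xp xp; rewrite subrr normr0; lra. Qed.

Lemma approx_cst c q : approx c (creal_cst A q) q 0.
Proof.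
apply/approx_pi => del del0; exists (gen_cst 0%N \top) => n _ c' u c0 _ cu.
rewrite (part_uniq (svalP (cauchy_cst A q n)) c0 cu (ccst_val _ _ _)).
by rewrite subrr normr0 add0r ltW.
Qed.

Lemma approx_add c x y p q e e' : approx c x p e -> approx c y q e' ->
  approx c (x + y) (p + q) (e + e').
Proof.
move=> xp yq; apply/approx_pi => del del0.
have [n1 H1] := xp _ (divr_gt0 del0 (@ltr0Sn rat 1)).
have [n2 H2] := yq _ (divr_gt0 del0 (@ltr0Sn rat 1)).
exists (cmax n1 n2) => n nn c' u c0 c'c cu.
rename c into b; rename c' into c.
cond_hit (svalP (creal_repr x n)) v; cond_hit (svalP (creal_repr y n)) w.
rewrite (part_uniq (svalP (cauchy_add _ _ n)) c0 cu (cadd_val H H0)).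
have := H1 _ (cmax_l nn) _ _ c0 c'c H.
have := H2 _ (cmax_r nn) _ _ c0 c'c H0.
by rewrite !ler_norml => /andP[? ?] /andP[? ?]; apply/andP; split; lra.
Qed.

Lemma approx_opp c x p e : approx c x p e -> approx c (- x) (- p) e.
Proof.
move=> xp; apply/approx_pi => del /xp[n0 H]; exists n0 => n nn c' u c0 c'c cu.
rename c into b; rename c' into c.
cond_hit (svalP (creal_repr x n)) v.
rewrite (part_uniq (svalP (cauchy_sub _ _ n)) c0 cu (csub_val (ccst_val _ _ _) H0)).
by rewrite sub0r opprK addrC distrC; apply: (H _ nn _ _ c0 c'c H0).
Qed.

Lemma mul_dist_le p q (u v a b : rat) : `|u - p| <= a -> `|v - q| <= b ->
  `|u * v - p * q| <= a * `|q| + `|p| * b + a * b.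
Proof.
move=> ua vb.
have -> : u * v - p * q = (u - p) * q + p * (v - q) + (u - p) * (v - q) by ring.
apply: le_trans (ler_normD _ _) _; apply: lerD; last by rewrite normrM ler_pM.
apply: le_trans (ler_normD _ _) _; rewrite !normrM.
by apply: lerD; [exact: ler_wpM2r|exact: ler_wpM2l].
Qed.

Lemma approx_mul c x y p q e e' : 0 <= e -> 0 <= e' ->
  approx c x p e -> approx c y q e' ->
  approx c (x * y) (p * q) (e * `|q| + `|p| * e' + e * e').
Proof.
move=> e0 e'0 xp yq; apply/approx_pi => del del0.
(* Raising [e] and [e'] by [h <= 1] raises the error of the product by at most [h * K], hence the
   choice of [h] below [del / K]. *)
pose K := `|p| + `|q| + e + e' + 1.
have K0 : 0 < K by rewrite /K; have := normr_ge0 p; have := normr_ge0 q; lra.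
pose h := Num.min 1 (del / K).
have h0 : 0 < h by rewrite lt_min ltr01 divr_gt0.
have h1 : h <= 1 by rewrite ge_min lexx.
have hK : h * K <= del by rewrite -ler_pdivlMr // ge_min lexx orbT.
have [n1 H1] := xp _ h0; have [n2 H2] := yq _ h0.
exists (cmax n1 n2) => n nn c' u c0 c'c cu.
rename c into b; rename c' into c.
cond_hit (svalP (creal_repr x n)) v; cond_hit (svalP (creal_repr y n)) w.
rewrite (part_uniq (svalP (cauchy_mul _ _ n)) c0 cu (cmul_val H H0)).
have := mul_dist_le (H1 _ (cmax_l nn) _ _ c0 c'c H) (H2 _ (cmax_r nn) _ _ c0 c'c H0).
move=> /le_trans; apply; move: hK; rewrite /K.
have hh : h * h <= h * 1 by rewrite ler_wpM2l // ltW.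
by lra.
Qed.

Lemma creal_le_approx x y :
  (forall c del, c != \bot -> 0 < del -> exists c' p q e f,
    [/\ c' != \bot, (c' <= c)%O, approx c' x p e, approx c' y q f &
        p + e + f <= q + del]) ->
  creal_le x y.
Proof.
(* A quarter of the tolerance is spent on each sequence term and a half on the [del] of the
   hypothesis. *)
move=> H eps eps0; have eps2 := half_pos (half_pos eps0).
have [n1 H1] := cauchyP (creal_repr x) eps2.
have [n2 H2] := cauchyP (creal_repr y) eps2.
exists (cmax n1 n2) => n nn; apply: gen_relI => c1 /below[c [c0 cc]] _.
cond_hit (svalP eps) e; cond_hit (svalP (creal_repr x n)) u.
cond_hit (svalP (creal_repr y n)) v.
exists u, (v + e), c; split=> //.
  exact: (gen_op_val 0%R (fun u v : rat => u + v)).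
have ce := crat_map_val (fun u => u / 2) (crat_map_val (fun u => u / 2) H0).
have xu : approx c x u (e / 2 / 2) := seq_approx_value H1 (cmax_l nn) H3 ce.
have yv : approx c y v (e / 2 / 2) := seq_approx_value H2 (cmax_r nn) H4 ce.
have e0 := pos_val eps0 c0 H0.
have [c' [p [q [a [b [c'0 c'c xp yq pq]]]]]] := H c (e / 2) c0 ltac:(lra).
have := approx_dist c'0 (approx_sub c'c xu) xp.
have := approx_dist c'0 (approx_sub c'c yv) yq.
by rewrite !ler_norml => /andP[? ?] /andP[? ?]; lra.
Qed.

Lemma creal_le_dest x y c p q e f : creal_le x y -> c != \bot ->
  approx c x p e -> approx c y q f -> p - e <= q + f.
Proof.
move=> xy c0 xp yq; apply: le_epsilon_rat => del del0.
have d3 : 0 < del / 3 by lra.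
have [n1 H1] := xp _ d3; have [n2 H2] := yq _ d3; have [n3 H3] := xy _ (cst_pos d3).
have [u [c1 [c10 c1c cu]]] :=
  part_hit (svalP (creal_repr x (cmax (cmax n1 n2) n3))) c0 (lex1 c).
have [v [c2 [c20 c21 cv]]] :=
  part_hit (svalP (creal_repr y (cmax (cmax n1 n2) n3))) c10 (lex1 c1).
have nn := @cnat_le_refl _ _ (cmax (cmax n1 n2) n3).
have := H1 _ (cmax_l (cmax_l nn)) _ _ c20 (le_trans c21 c1c) (le_trans c21 cu).
have := H2 _ (cmax_r (cmax_l nn)) _ _ c20 (le_trans c21 c1c) cv.
have := gen_relP (H3 _ (cmax_r nn)) c20 (le_trans c21 cu)
  (gen_op_val 0%R (fun u v : rat => u + v) cv (cst_val _ _)).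
by rewrite !ler_norml => ? /andP[? ?] /andP[? ?]; lra.
Qed.

(** The criterion [creal_le_approx] only tests a dense set of conditions, and approximations on [c']
    depend only on the restrictions to [c']. *)
Lemma creal_le_local x y :
  (forall c, c != \bot -> exists c' x' y', [/\ c' != \bot, (c' <= c)%O,
     crestr c' x = crestr c' x',
     crestr c' y = crestr c' y' & creal_le x' y']) ->
  creal_le x y.
Proof.
move=> H; apply: creal_le_approx => c del c0 del0.
have [c1 [x' [y' [c10 c1c xx' yy' xy]]]] := H _ c0.
have d4 : 0 < del / 4 by lra.
have [c2 [p [c20 c21 xp]]] := approx_exists x' d4 c10.
have [c3 [q [c30 c32 yq]]] := approx_exists y' d4 c20.
have c31 := le_trans c32 c21.
have := creal_le_dest xy c30 (approx_sub c32 xp) yq => pq.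
exists c3, p, q, (del / 4), (del / 4); split=> //; last by lra.
- exact: le_trans c31 c1c.
- apply: (approx_restr (x := x')); last exact: approx_sub xp.
  by symmetry; apply: cond_consistent xx'.
- apply: (approx_restr (x := y')); last exact: yq.
  by symmetry; apply: cond_consistent yy'.
Qed.

Lemma creal_le_anti x y : creal_le x y -> creal_le y x -> x = y.
Proof.
move=> xy yx; rewrite -(creal_reprK x) -(creal_reprK y); apply/creal_piP => eps eps0.
have [n1 H1] := xy _ eps0; have [n2 H2] := yx _ eps0.
exists (cmax n1 n2) => n nn; apply: rel_restrI => c1 /below[c [c0 cc]] _.
cond_hit (svalP eps) e; cond_hit (svalP (creal_repr x n)) u.
cond_hit (svalP (creal_repr y n)) v.
exists `|u - v|, e, c; split=> //; first exact: dist_val.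
have := gen_relP (H1 _ (cmax_l nn)) c0 H0
  (gen_op_val 0%R (fun u v : rat => u + v) H3 H).
have := gen_relP (H2 _ (cmax_r nn)) c0 H3
  (gen_op_val 0%R (fun u v : rat => u + v) H0 H).
by rewrite ler_norml => ? ?; apply/andP; split; lra.
Qed.

End Approximation.

(** * Gluing *)

Section Gluing.
Context {d : Order.disp_t} {A : cbaType d}.
Implicit Types (a b c : A).

(** The suprema of the [P e] may overlap; from each is removed what the values of smaller [pickle]
    cover. The result still covers [\top] because below every condition some available index is
    least. *)
Lemma dense_part (E : countType) (P : E -> A -> Prop) :
  (forall e c c', P e c -> (c' <= c)%O -> P e c') ->
  (forall c, c != \bot -> exists c' e, [/\ c' != \bot, (c' <= c)%O & P e c']) ->
  exists u : gen_car E (\top : A), forall e c, c != \bot -> (c <= sval u e)%O ->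
    exists c', [/\ c' != \bot, (c' <= c)%O & P e c'].
Proof.
move=> mono dense.
pose before (e : E) := csup [set c | exists2 e', (pickle e' < pickle e)%N & P e' c]%classic.
pose u (e : E) := (csup (P e) `&` ~` before e)%O.
have uniq c i j : c != \bot -> (c <= u i)%O -> (c <= u j)%O -> (pickle i < pickle j)%N -> False.
  move=> /negP c0; rewrite /u !lexI => /andP[ci _] /andP[_ cj] ij; apply: c0.
  rewrite -lex0 -(meetxC (before j)) lexI cj andbT (le_trans ci) //.
  by apply: csup_le => b Pb; apply: csup_ub; exists i.
have uP : is_part \top u.
  apply: is_partI.
  - move=> c i j c0 ci cj; apply: (pcan_inj (@pickleK E)).
    by case: (ltngtP (pickle i) (pickle j)) => // /uniq H; case: (H c).
  - by move=> i; rewrite lex1.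
  - move=> c c0 _.
    (* At the least [n] with [Q n], the condition found cannot meet [before e]: otherwise a value of
       smaller index would be available below [c]. *)
    pose Q n := exists e c', [/\ pickle e = n :> nat, c' != \bot, (c' <= c)%O & P e c'].
    have exQ : exists n, `[< Q n >].
      have [c' [e [c'0 c'c Pe]]] := dense _ c0.
      by exists (pickle e); apply/asboolP; exists e, c'.
    case: (ex_minnP exQ) => n /asboolP[e [c' [en c'0 c'c Pe]]] minn.
    exists e, c'; split=> //; rewrite lexI (csup_ub Pe) /= -disj_leC.
    apply/negPn/negP => ne.
    have [b [e' e'e Pb] ne'] := csup_hit ne (leIr _ _).
    have : (n <= pickle e')%N.
      apply: minn; apply/asboolP; exists e', ((c' `&` before e) `&` b)%O; split=> //.
        by apply: le_trans (leIl _ _) _; apply: le_trans (leIl _ _) _.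
      by apply: mono Pb _; apply: leIr.
    by rewrite leqNgt -en e'e.
exists (exist _ u uP) => e c c0 /=; rewrite lexI => /andP[ce _].
have [b Pb cb] := csup_hit c0 ce.
by exists (c `&` b)%O; split=> //; [exact: leIl|apply: mono Pb _; exact: leIr].
Qed.

Lemma compl_part a : is_part \top (fun b : bool => if b then a else (~` a)%O).
Proof.
split=> [[] [] // _|]; rewrite ?meetxC ?meetCx //.
apply/le_anti; rewrite lex1 /= -(joinxC a) leUx.
by apply/andP; split; apply: csup_ub; [exists true|exists false].
Qed.

Lemma cond_mix (X : condSet A) a (x y : X \top) :
  exists z : X \top, cond_restr a z = cond_restr a x /\
    cond_restr (~` a)%O z = cond_restr (~` a)%O y.
Proof.
have [z [zP _]] := cond_stable (fun b : bool => if b then x else y) (compl_part a).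
by exists z; split; [exact: (zP true)|exact: (zP false)].
Qed.

Lemma cond_mix_uniq (X : condSet A) a (x y : X \top) :
  cond_restr a x = cond_restr a y -> cond_restr (~` a)%O x = cond_restr (~` a)%O y ->
  x = y.
Proof.
move=> xy xyC.
(* The glued family is constantly [x], so [x] and [y] both equal its unique gluing. *)
have [z [_ zU]] := cond_stable (fun b : bool => if b then x else x) (compl_part a).
by rewrite -(zU x) ?(zU y) // => -[].
Qed.

(** * Conditional functions from local maps on [\top] *)

Section LocalFunction.
Context (X Y : condSet A) (h : X \top -> Y \top).
Context (hP : forall a x y, cond_restr a x = cond_restr a y ->
  cond_restr a (h x) = cond_restr a (h y)).

(** An element on [a] is lifted to [\top] by choice; [hP] makes the value independent of the
    lift. *)
Definition local_fun a (x : X a) : Y a := cond_restr a (h (sval (cid (cond_surj x)))).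

Lemma local_fun_subproof a (x : X \top) :
  local_fun (cond_restr a x) = cond_restr a (local_fun (a := \top) x).
Proof.
rewrite /local_fun; case: cid => z zx /=; case: cid => t tx /=.
by rewrite cond_top; apply: hP; rewrite zx -tx cond_top.
Qed.

Definition condFun_of_local : condFun X Y := CondFun local_fun_subproof.

Lemma condFun_of_localE x : condFun_of_local x = h x.
Proof.
rewrite /condFun_of_local /cond_fun1 /= /local_fun cond_top.
by case: cid => z /=; rewrite cond_top => ->.
Qed.

End LocalFunction.

End Gluing.

(** * Conditional reals from dense families of approximations *)

Section RealOfApproximation.
Context {d : Order.disp_t} {A : cbaType d}.
Implicit Types (a b c : A) (p q e del : rat).

Section StepSequence.
Context (u : nat -> crat A \top).

(** A conditional natural number is a partition of [\top] indexed by the naturals. Gluing along it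
    extends an ordinary sequence to conditional indices. *)
Definition step_seq1 (n : cnat A \top) : crat A \top := gen_glue u (svalP n).

Lemma step_seq1_val n c i q : (c <= sval n i)%O -> (c <= sval (u i) q)%O ->
  (c <= sval (step_seq1 n) q)%O.
Proof. exact: gen_glue_val. Qed.

Lemma step_seq_local a (m n : cnat A \top) : cond_restr a m = cond_restr a n ->
  cond_restr a (step_seq1 m) = cond_restr a (step_seq1 n).
Proof.
move=> mn; apply: Defs.gen_eq => c1 /below[c [c0 cc]] c1a; have ca := le_trans cc c1a.
cond_hit (svalP m) i; cond_hit (svalP (u i)) q.
have ni : (c <= sval n i)%O.
  have : (c <= sval (cond_restr a m) i)%O by apply: gen_restr_val.
  by rewrite mn lexI => /andP[].
exists q, c; split=> //; apply: gen_restr_val => //.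
  exact: step_seq1_val H H0.
exact: step_seq1_val ni H0.
Qed.

Definition step_seq : condFun (cnat A) (crat A) := condFun_of_local step_seq_local.

Lemma step_seq_val (n : cnat A \top) c i q : (c <= sval n i)%O -> (c <= sval (u i) q)%O ->
  (c <= sval (step_seq n) q)%O.
Proof. by rewrite condFun_of_localE; apply: step_seq1_val. Qed.

End StepSequence.

Definition prec (n : nat) : rat := n.+1%:R^-1.

Definition prec_index e : nat := Num.bound (e^-1).

Lemma prec_gt0 n : 0 < prec n.
Proof. by rewrite invr_gt0. Qed.

Lemma prec_indexP e n : 0 < e -> (prec_index e <= n)%N -> prec n <= e.
Proof.
move=> e0 en; rewrite /prec -[leRHS]invrK lef_pV2 ?posrE ?invr_gt0 //.
have /le_trans : e^-1 <= (Num.bound (e^-1))%:R.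
  by apply: ltW; apply: archi_boundP; rewrite invr_ge0 ltW.
by apply; rewrite ler_nat; apply: leq_trans en _.
Qed.

Context (P : A -> rat -> rat -> Prop).
Context (P_sub : forall c c' p e, P c p e -> (c' <= c)%O -> P c' p e).
Context (P_dense : forall c e, c != \bot -> 0 < e ->
  exists c' p, [/\ c' != \bot, (c' <= c)%O & P c' p e]).
Context (P_dist : forall c p q e e', c != \bot -> P c p e -> P c q e' ->
  `|p - q| <= e + e').

(** For each [n], [dense_part] provides a conditional rational whose values are locally in [P] with
    error [prec n]. For the sequence they form, [P_dist] yields both the Cauchy property and the
    agreement of the limit with all of [P]. *)
Lemma creal_of_approx : exists x : creal1 A, forall c p e, P c p e -> approx c x p e.
Proof.
have /boolp.choice[u uP] : forall n, exists v : crat A \top, forall q c, c != \bot ->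
    (c <= sval v q)%O -> exists c', [/\ c' != \bot, (c' <= c)%O & P c' q (prec n)].
  move=> n; apply: dense_part => [q c c' Pq c'c|c c0]; first exact: P_sub Pq c'c.
  exact: P_dense (prec_gt0 n).
have sC : is_cauchy (step_seq u).
  (* The threshold follows the local value [e] of [eps], so it is a conditional natural number;
     beyond it each term has error at most [e / 2]. *)
  move=> eps eps0; exists (gen_map1 (fun e => prec_index (e / 2)) eps) => m n nm nn.
  apply: gen_relI => c1 /below[c [c0 cc]] _.
  cond_hit (svalP eps) e; cond_hit (svalP m) i; cond_hit (svalP n) j.
  cond_hit (svalP (u i)) p; cond_hit (svalP (u j)) q.
  have e0 := pos_val eps0 c0 H.
  have ei := gen_relP nm c0 (gen_map_val _ H) H0.
  have ej := gen_relP nn c0 (gen_map_val _ H) H1.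
  exists `|p - q|, e, c; split=> //.
    by apply: dist_val; [exact: step_seq_val H2|exact: step_seq_val H3].
  have [c2 [c20 c2c Pp]] := uP _ _ _ c0 H2.
  have [c3 [c30 c32 Pq]] := uP _ _ _ c20 (le_trans c2c H3).
  have := P_dist c30 (P_sub Pp c32) Pq.
  have := prec_indexP (divr_gt0 e0 (@ltr0Sn rat 1)) ei.
  have := prec_indexP (divr_gt0 e0 (@ltr0Sn rat 1)) ej.
  lra.
exists (creal_pi \top (CauchySeq sC)) => c p e Pp; apply/approx_pi => del del0.
exists (gen_cst (prec_index del) \top) => n nn c' v c'0 c'c cv.
have {}Pp := P_sub Pp c'c; rename c into b; rename c' into c.
have [i [c1 [c10 c1c ci]]] := part_hit (svalP n) c'0 (lex1 c).
have [q [c2 [c20 c21 cq]]] := part_hit (svalP (u i)) c10 (lex1 c1).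
have c2c := le_trans c21 c1c.
have -> := part_uniq (svalP (step_seq u n)) c20 (le_trans c2c cv)
  (step_seq_val (le_trans c21 ci) cq).
have [c3 [c30 c32 Pq]] := uP _ _ _ c20 cq.
have := P_dist c30 Pq (P_sub Pp (le_trans c32 c2c)).
have := prec_indexP del0 (gen_relP nn c20 (cst_val _ _) (le_trans c21 ci)).
lra.
Qed.

End RealOfApproximation.

(** * Order, suprema and inverses *)

Section CrealOrder.
Context {d : Order.disp_t} {A : cbaType d}.
Implicit Types (a b c : A) (p q e del : rat) (x y z l m : creal1 A).

Local Notation crestr := (@cond_restr _ _ (creal A)).

Lemma approx_exists2 x y e c : 0 < e -> c != \bot -> exists c' p q,
  [/\ c' != \bot, (c' <= c)%O, approx c' x p e & approx c' y q e].
Proof.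
move=> e0 /(approx_exists x e0)[c1 [p [c10 c1c xp]]].
have [c2 [q [c20 c21 yq]]] := approx_exists y e0 c10.
by exists c2, p, q; split=> //; [exact: le_trans c21 c1c|exact: approx_sub xp].
Qed.

Lemma creal_eq_approx x y :
  (forall c del, c != \bot -> 0 < del -> exists c' p q e f,
    [/\ c' != \bot, (c' <= c)%O, approx c' x p e, approx c' y q f &
        `|p - q| + e + f <= del]) ->
  x = y.
Proof.
move=> H; apply: creal_le_anti; apply: creal_le_approx => c del c0 /(H c del c0).
  move=> [c' [p [q [e [f [c'0 c'c xp yq pq]]]]]]; exists c', p, q, e, f; split=> //.
  by have := ler_norm (p - q); lra.
move=> [c' [p [q [e [f [c'0 c'c xp yq pq]]]]]]; exists c', q, p, f, e; split=> //.
by have := ler_norm (q - p); rewrite distrC; lra.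
Qed.

Lemma creal_le_refl x : creal_le x x.
Proof.
apply: creal_le_approx => c del c0 del0.
have [|c' [p [c'0 c'c xp]]] := @approx_exists _ _ x (del / 2) _ _ c0; first lra.
by exists c', p, p, (del / 2), (del / 2); split=> //; lra.
Qed.

Lemma creal_le_trans y x z : creal_le x y -> creal_le y z -> creal_le x z.
Proof.
move=> xy yz; apply: creal_le_approx => c del c0 del0.
have e0 : 0 < del / 6 by lra.
have [c1 [p [q [c10 c1c xp yq]]]] := approx_exists2 x y e0 c0.
have [c2 [r [c20 c21 zr]]] := approx_exists z e0 c10.
have := creal_le_dest xy c10 xp yq.
have := creal_le_dest yz c20 (approx_sub c21 yq) zr => ? ?.
exists c2, p, r, (del / 6), (del / 6); split=> //; last lra.
  exact: le_trans c21 c1c.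
exact: approx_sub xp.
Qed.

Lemma creal_leD x y z l : creal_le x y -> creal_le z l -> creal_le (x + z) (y + l).
Proof.
move=> xy zl; apply: creal_le_approx => c del c0 del0.
have e0 : 0 < del / 8 by lra.
have [c1 [p [q [c10 c1c xp yq]]]] := approx_exists2 x y e0 c0.
have [c2 [r [s [c20 c21 zr ls]]]] := approx_exists2 z l e0 c10.
have := creal_le_dest xy c10 xp yq; have := creal_le_dest zl c20 zr ls => ? ?.
exists c2, (p + r), (q + s), (del / 8 + del / 8), (del / 8 + del / 8); split=> //.
- exact: le_trans c21 c1c.
- by apply: approx_add => //; apply: approx_sub xp.
- by apply: approx_add => //; apply: approx_sub yq.
- lra.
Qed.

Lemma creal_subr_ge0 x y : creal_le 0 (y - x) <-> creal_le x y.
Proof.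
split=> H; last by rewrite -(subrr x); apply: creal_leD => //; apply: creal_le_refl.
by rewrite -(subrK x y) -[X in creal_le X _]add0r; apply: creal_leD => //; apply: creal_le_refl.
Qed.

Lemma creal_le_cst p q : p <= q -> creal_le (creal_cst A p) (creal_cst A q).
Proof.
move=> pq; apply: creal_le_approx => c del c0 del0; exists c, p, q, 0, 0.
by split=> //; [exact: approx_cst|exact: approx_cst|lra].
Qed.

Lemma creal_mul_ge0 x y : creal_le 0 x -> creal_le 0 y -> creal_le 0 (x * y).
Proof.
move=> x0 y0; apply: creal_le_approx => c del c0 del0.
have [c1 [p0 [q0 [c10 c1c xp0 yq0]]]] := approx_exists2 x y ltr01 c0.
(* [K] bounds all finer approximations by means of the rough ones [p0] and [q0]; the errors below
   add up to at most [4 * (h * K)]. *)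
pose K := `|p0| + `|q0| + 5.
have K0 : 0 < K by rewrite /K; have := normr_ge0 p0; have := normr_ge0 q0; lra.
pose h := Num.min 1 (del / (4 * K)).
have h0 : 0 < h by rewrite lt_min ltr01 divr_gt0 // mulr_gt0.
have h1 : h <= 1 by rewrite ge_min lexx.
have hK : h * (4 * K) <= del by rewrite -ler_pdivlMr ?mulr_gt0 // ge_min lexx orbT.
have [c2 [p [q [c20 c21 xp yq]]]] := approx_exists2 x y h0 c10.
have zero c' := @approx_cst _ A c' 0.
have p_ge := creal_le_dest x0 c20 (zero _) xp.
have q_ge := creal_le_dest y0 c20 (zero _) yq.
have pp := approx_dist c20 xp (approx_sub c21 xp0).
have qq := approx_dist c20 yq (approx_sub c21 yq0).
have pK : `|p| <= K.
  have := normr_ge0 q0; have := ler_normD (p - p0) p0; rewrite subrK /K; lra.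
have qK : `|q| <= K.
  have := normr_ge0 p0; have := ler_normD (q - q0) q0; rewrite subrK /K; lra.
have := approx_mul (ltW h0) (ltW h0) xp yq.
set E := (X in approx _ _ _ X) => xyE.
exists c2, 0, (p * q), 0, E; split=> //; first exact: le_trans c21 c1c.
have E_le : E <= h * K + K * h + h * 1.
  by rewrite /E; do ?apply: lerD; rewrite ?ler_wpM2l ?ler_wpM2r // ltW.
(* Both factors are at least [- h], so the product can only be negative when one of them lies
   between [- h] and 0. *)
have pq_ge : - (h * K) <= p * q.
  move: pK qK; rewrite !ler_norml => /andP[? ?] /andP[? ?].
  have [p0'|p0'] := leP 0 p.
    have : p * (- h) <= p * q by rewrite ler_wpM2l //; lra.
    have : h * p <= h * K by rewrite ler_wpM2l // ltW.
    lra.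
  have [q0'|q0'] := leP 0 q.
    have : (- h) * q <= p * q by rewrite ler_wpM2r //; lra.
    have : h * q <= h * K by rewrite ler_wpM2l // ltW.
    lra.
  have : 0 <= p * q by rewrite nmulr_rge0 // ltW.
  have := mulr_ge0 (ltW h0) (ltW K0); lra.
have : h * 1 <= h * K.
  by rewrite ler_wpM2l ?ltW // /K; have := normr_ge0 p0; have := normr_ge0 q0; lra.
lra.
Qed.

Lemma creal_le_pM2l l x y : creal_le 0 l -> creal_le x y -> creal_le (l * x) (l * y).
Proof.
move=> l0 /creal_subr_ge0 xy; apply/creal_subr_ge0.
by rewrite -mulrBr; apply: creal_mul_ge0.
Qed.

Lemma creal_bounded_multiples_eq0 x y : (forall l, creal_le (l * x) y) -> x = 0.
Proof.
(* The multiples of [- x] are those of [x], so one inequality gives both. *)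
suff {x y} H x y : (forall l, creal_le (l * x) y) -> creal_le x 0.
  move=> xy; apply: creal_le_anti; first exact: H xy.
  have /creal_subr_ge0 : creal_le (- x) 0 by apply: (H _ y) => l; rewrite mulrN -mulNr.
  by rewrite (@sub0r (creal1 A)) opprK.
move=> xy; apply: creal_le_approx => c del c0 del0.
have e0 : 0 < del / 4 by lra.
have [c1 [p [c10 c1c xp]]] := approx_exists x e0 c0.
have [c2 [q [c20 c21 yq]]] := approx_exists y ltr01 c10.
exists c1, p, 0, (del / 4), 0; split=> //; first exact: approx_cst.
rewrite leNgt; apply/negP => pd.
(* On [c1], [x] is now at least [p - del / 4 > del / 4]; the factor [t] brings this to [|q| + 2],
   above the bound [q + 1] of [y]. *)
pose t := (`|q| + 2) / (del / 4).
have t0 : 0 < t by rewrite divr_gt0 //; have := normr_ge0 q; lra.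
have := approx_mul (lexx 0) (ltW e0) (approx_cst c2 t) (approx_sub c21 xp).
move=> /creal_le_dest -/(_ _ _ _ (xy _) c20 yq).
have : t * (del / 4) <= t * (p - del / 4) by rewrite ler_wpM2l ?ltW //; lra.
rewrite {1}/t divfK ?lt0r_neq0 // (gtr0_norm t0) mul0r mul0r add0r addr0.
by have := ler_norm q; lra.
Qed.

(** As [creal_le] compares reals on [\top] only, comparison with a rational on [c] is expressed
    through all approximations below [c]. *)
Definition ge_on c x p := forall c' u v, c' != \bot -> (c' <= c)%O ->
  approx c' x u v -> p <= u + v.
Definition le_on c x p := forall c' u v, c' != \bot -> (c' <= c)%O ->
  approx c' x u v -> u - v <= p.

Lemma approx_ge_on c x p e q : approx c x p e -> q <= p - e -> ge_on c x q.
Proof.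
move=> xp qp c' u v c'0 c'c xu.
by have := approx_dist c'0 xu (approx_sub c'c xp); rewrite ler_norml => /andP[]; lra.
Qed.

Lemma ge_on_sub c c' x p : (c' <= c)%O -> ge_on c x p -> ge_on c' x p.
Proof. by move=> c'c H b u v b0 bc'; apply: H => //; apply: le_trans bc' c'c. Qed.

Lemma le_on_sub c c' x p : (c' <= c)%O -> le_on c x p -> le_on c' x p.
Proof. by move=> c'c H b u v b0 bc'; apply: H => //; apply: le_trans bc' c'c. Qed.

Lemma ge_on_le_on c x p q : c != \bot -> ge_on c x p -> le_on c x q -> p <= q.
Proof.
move=> c0 xp xq; apply: le_epsilon_rat => del del0.
have [|c' [u [c'0 c'c xu]]] := @approx_exists _ _ x (del / 2) _ _ c0; first lra.
by have := xp _ _ _ c'0 c'c xu; have := xq _ _ _ c'0 c'c xu; lra.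
Qed.

(** * Suprema of bounded sets *)

Section Supremum.
Context (S : set (creal1 A)).

(** This plays the role of [approx] for the supremum of [S] before that supremum is constructed. *)
Definition sup_approx c p e :=
  (exists2 x, S x & ge_on c x (p - e)) /\ (forall y, S y -> le_on c y (p + e)).

Lemma sup_approx_sub c c' p e : sup_approx c p e -> (c' <= c)%O -> sup_approx c' p e.
Proof.
move=> [[x Sx xp] H] c'c; split; first by exists x => //; apply: ge_on_sub xp.
by move=> y /H; apply: le_on_sub.
Qed.

Lemma sup_approx_dist c p q e e' : c != \bot -> sup_approx c p e ->
  sup_approx c q e' -> `|p - q| <= e + e'.
Proof.
move=> c0 [[x Sx xp] Hp] [[y Sy yq] Hq]; rewrite ler_norml; apply/andP; split.
  by have := ge_on_le_on c0 yq (Hp _ Sy); lra.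
by have := ge_on_le_on c0 xp (Hq _ Sx); lra.
Qed.

Lemma sup_approx_exists c e : (exists x, S x) ->
  (exists M, forall y, S y -> creal_le y M) -> c != \bot -> 0 < e ->
  exists c' p, [/\ c' != \bot, (c' <= c)%O & sup_approx c' p e].
Proof.
move=> [x0 Sx0] [M SM] c0 e0.
have [c1 [p0 [q0 [c10 c1c xp MP]]]] := approx_exists2 x0 M ltr01 c0.
(* The grid of step [e] starts at a lower bound of [x0] on [c1]. The bound [M] limits the grid
   points that an element of [S] can reach on some condition below [c1]. *)
pose Q n := exists c' x, [/\ c' != \bot, (c' <= c1)%O, S x & ge_on c' x (p0 - 1 + n%:R * e)].
have exQ : exists n, `[< Q n >].
  exists 0%N; apply/asboolP; exists c1, x0; split=> //.
  by apply: approx_ge_on xp _; lra.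
have ubQ n : `[< Q n >] -> (n <= Num.bound ((`|q0 - p0| + 2) / e)%R)%N.
  move=> /asboolP[c' [x [c'0 c'c Sx xn]]].
  rewrite -(ler_nat rat); apply: le_trans (ltW (archi_boundP _)); last first.
    by rewrite divr_ge0 ?ltW //; have := normr_ge0 (q0 - p0); lra.
  rewrite ler_pdivlMr //.
  have xM : le_on c' x (q0 + 1).
    move=> b u v b0 bc' xu.
    exact: creal_le_dest (SM _ Sx) b0 xu (approx_sub (le_trans bc' c'c) MP).
  by have := ge_on_le_on c'0 xn xM; have := ler_norm (q0 - p0); lra.
case: (ex_maxnP exQ ubQ) => n /asboolP[c2 [x [c20 c21 Sx xn]]] maxn.
exists c2, (p0 - 1 + n%:R * e); split=> //; first exact: le_trans c21 c1c.
split; first by exists x => // b u v b0 bc xu; have := xn b u v b0 bc xu; lra.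
(* An element exceeding the next grid point on some [b] would contradict the maximality of [n]. *)
move=> y Sy b u v b0 bc yu; rewrite leNgt; apply/negP => lt.
have : (n.+1 <= n)%N; last by rewrite ltnn.
apply: maxn; apply/asboolP; exists b, y; split=> //; first exact: le_trans bc c21.
by apply: approx_ge_on yu _; rewrite -natr1; lra.
Qed.

Lemma creal_sup : (exists x, S x) -> (exists M, forall y, S y -> creal_le y M) ->
  exists x, (forall y, S y -> creal_le y x) /\
    forall M, (forall y, S y -> creal_le y M) -> creal_le x M.
Proof.
move=> S0 SM.
have [x xP] := creal_of_approx sup_approx_sub (fun c e => @sup_approx_exists c e S0 SM) sup_approx_dist.
exists x; split=> [y Sy|{}M {}SM]; apply: creal_le_approx => c del c0 del0.
  have e0 : 0 < del / 4 by lra.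
  have [c1 [t [c10 c1c Pt]]] := sup_approx_exists S0 SM c0 e0.
  have [c2 [u [c20 c21 yu]]] := approx_exists y e0 c10.
  exists c2, u, t, (del / 4), (del / 4); split=> //; first exact: le_trans c21 c1c.
    exact: approx_sub (xP _ _ _ Pt).
  by have [_ /(_ _ Sy _ _ _ c20 c21 yu)] := Pt; lra.
have e0 : 0 < del / 6 by lra.
have [c1 [t [c10 c1c Pt]]] := sup_approx_exists S0 (ex_intro _ M SM) c0 e0.
have [[y Sy yt] _] := Pt.
have [c2 [u [w [c20 c21 yu Mw]]]] := approx_exists2 y M e0 c10.
exists c2, t, w, (del / 6), (del / 6); split=> //; first exact: le_trans c21 c1c.
  exact: approx_sub (xP _ _ _ Pt).
by have := yt _ _ _ c20 c21 yu; have := creal_le_dest (SM _ Sy) c20 yu Mw; lra.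
Qed.

End Supremum.

(** A rational bound that does not vary with the condition keeps the estimates for the inverse
    uniform. *)
Definition creal_pos m : Prop := exists2 q, 0 < q & creal_le (creal_cst A q) m.

Lemma creal_pos_ge0 m : creal_pos m -> creal_le 0 m.
Proof. by move=> [q /ltW/creal_le_cst q0]; apply: creal_le_trans. Qed.

(** * Inverses *)

Section Inverse.
Context (m : creal1 A).

(** The last clause is [|p - 1/w| <= e] cleared of denominators, for every [w] in the interval to
    which [m] is confined. *)
Definition inv_approx c p e := exists u v, [/\ 0 < u - v, v <= e, approx c m u v &
  forall w, u - v <= w -> w <= u + v -> `|w * p - 1| <= e * w].

Lemma inv_approx_sub c c' p e : inv_approx c p e -> (c' <= c)%O -> inv_approx c' p e.
Proof.
by move=> [u [v [? ? mu ?]]] c'c; exists u, v; split=> //; apply: approx_sub mu.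
Qed.

Lemma inv_approx_dist c p q e e' : c != \bot -> inv_approx c p e ->
  inv_approx c q e' -> `|p - q| <= e + e'.
Proof.
move=> c0 [u [v [uv ve mu H]]] [u' [v' [uv' ve' mu' H']]].
have := approx_dist c0 mu mu'; rewrite ler_norml => /andP[? ?].
have v0 := approx_ge0 c0 mu; have v'0 := approx_ge0 c0 mu'.
(* The larger of the two left ends lies in both intervals; [p] and [q] are both compared with its
   inverse. *)
pose w := Num.max (u - v) (u' - v').
have w1 : u - v <= w by rewrite le_max lexx.
have w2 : u' - v' <= w by rewrite le_max lexx orbT.
have w3 : w <= u + v by rewrite ge_max; apply/andP; split; lra.
have w4 : w <= u' + v' by rewrite ge_max; apply/andP; split; lra.
have w0 : 0 < w := lt_le_trans uv w1.
rewrite -(ler_pM2r w0) -{1}(gtr0_norm w0) -normrM.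
have := H _ w1 w3; have := H' _ w2 w4.
by rewrite !ler_norml => /andP[? ?] /andP[? ?]; apply/andP; split; lra.
Qed.

Lemma inv_approx_exists c e : creal_pos m -> c != \bot -> 0 < e ->
  exists c' p, [/\ c' != \bot, (c' <= c)%O & inv_approx c' p e].
Proof.
move=> [q q0 qm] c0 e0.
(* The bound [q / 4] keeps [u - h] above [q / 2]; the last one makes [h] at most [e * w * u] for [w]
   in the interval. *)
pose h := Num.min e (Num.min (q / 4) (e * (q / 2 * (q / 2)))).
have q20 : 0 < q / 2 by lra.
have h0 : 0 < h by rewrite lt_min e0 lt_min divr_gt0 // mulr_gt0 // mulr_gt0.
have h1 : h <= e by rewrite ge_min lexx.
have h2 : h <= q / 4 by rewrite !ge_min lexx !orbT.
have h3 : h <= e * (q / 2 * (q / 2)) by rewrite !ge_min lexx !orbT.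
have [c1 [u [c10 c1c mu]]] := approx_exists m h0 c0.
have := creal_le_dest qm c10 (approx_cst _ _) mu => qu.
have u0 : 0 < u by lra.
exists c1, u^-1; split=> //; exists u, h; split=> // [|w uw wu]; first lra.
have -> : w * u^-1 - 1 = (w - u) / u by rewrite mulrBl divff // lt0r_neq0.
rewrite normrM normfV (gtr0_norm u0) ler_pdivrMr //.
apply: (@le_trans _ _ h); first by rewrite ler_norml; apply/andP; split; lra.
apply: le_trans h3 _; rewrite -(mulrA e) ler_pM2l // ler_pM //; lra.
Qed.

Lemma creal_inv : creal_pos m -> exists2 n, m * n = 1 & creal_le 0 n.
Proof.
move=> m_pos; have [q q0 qm] := m_pos.
have [n nP] := creal_of_approx inv_approx_sub (fun c e => @inv_approx_exists c e m_pos) inv_approx_dist.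
exists n.
  apply: creal_eq_approx => c del c0 del0.
  have [c1 [U [c10 c1c mU]]] := approx_exists m ltr01 c0.
  (* With [u <= |U| + 2] and [|t| <= 2 / q + 1], the distance from [u * t] to 1 and the product
     error together stay below [h * K]. *)
  pose K := 2 / q + 2 * `|U| + 8.
  have q20 : 0 < 2 / q by rewrite divr_gt0.
  have K0 : 0 < K by rewrite /K; have := normr_ge0 U; lra.
  pose h := Num.min 1 (Num.min (q / 2) (del / K)).
  have h0 : 0 < h by rewrite !lt_min !divr_gt0.
  have h1 : h <= 1 by rewrite ge_min lexx.
  have h2 : h <= q / 2 by rewrite !ge_min lexx !orbT.
  have h3 : h * K <= del by rewrite -ler_pdivlMr // !ge_min lexx !orbT.
  have [c2 [t [c20 c21 Pt]]] := inv_approx_exists m_pos c10 h0.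
  have nt := nP _ _ _ Pt; have [u [v [uv vh mu H]]] := Pt.
  have v0 := approx_ge0 c20 mu.
  have := creal_le_dest qm c20 (approx_cst _ _) mu => qu.
  have := approx_dist c20 mu (approx_sub c21 mU) => uU.
  have u0 : 0 < u by lra.
  have uq : q / 2 <= u by lra.
  have := H u; move=> /(_ ltac:(lra) ltac:(lra)) ut.
  have tq : `|t| <= 2 / q + h.
    rewrite -(ler_pM2l u0) -{1}(gtr0_norm u0) -normrM.
    have := ler_normD (u * t - 1) 1; rewrite subrK normr1.
    have : q / 2 * (2 / q) <= u * (2 / q) by rewrite ler_pM2r.
    have -> : q / 2 * (2 / q) = 1 by field; rewrite lt0r_neq0.
    lra.
  exists c2, (u * t), 1, (v * `|t| + `|u| * h + v * h), 0; split=> //.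
  - exact: le_trans c21 c1c.
  - exact: approx_mul v0 (ltW h0) mu nt.
  - exact: approx_cst.
  have uU' : u <= `|U| + 2 by have := ler_norm (u - U); have := ler_norm U; lra.
  rewrite (gtr0_norm u0) addr0.
  have a1 : v * `|t| <= h * (2 / q + 1) by rewrite ler_pM //; lra.
  have a2 : h * u <= h * (`|U| + 2) by rewrite ler_pM2l.
  have a3 : v * h <= h * 1 by rewrite ler_pM // ltW.
  move: h3; rewrite /K; lra.
apply: creal_le_approx => c del c0 del0.
have e0 : 0 < del / 2 by lra.
have [c1 [t [c10 c1c Pt]]] := inv_approx_exists m_pos c0 e0.
exists c1, 0, t, 0, (del / 2); split=> //; [exact: approx_cst|exact: nP|].
have [u [v [uv vh mu H]]] := Pt; have v0 := approx_ge0 c10 mu.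
have u0 : 0 < u by lra.
have := H u; move=> /(_ ltac:(lra) ltac:(lra)); rewrite ler_norml => /andP[ut _].
have : 0 <= u * (t + del / 2) by lra.
by rewrite pmulr_rge0 //; lra.
Qed.

End Inverse.

(** * Local trichotomy *)

Lemma meet_case b c : b != \bot -> (b `&` c != \bot)%O \/ (b <= ~` c)%O.
Proof. by move=> b0; have [bc|] := eqVneq (b `&` c)%O \bot; [right; rewrite -disj_leC bc|left]. Qed.

Lemma creal_pos_approx c m p e : approx c m p e -> 0 < p - e ->
  approx (~` c)%O m 1 0 -> creal_pos m.
Proof.
move=> mp pe m1; exists (Num.min (p - e) 1); first by rewrite lt_min pe ltr01.
have q1 : Num.min (p - e) 1 <= p - e by rewrite ge_min lexx.
have q2 : Num.min (p - e) 1 <= 1 by rewrite ge_min lexx orbT.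
move: q1 q2; set q := Num.min _ _ => q1 q2.
apply: creal_le_approx => b del b0 del0.
have [bc|bc] := meet_case c b0; last first.
  exists b, q, 1, 0, 0; split=> //; [exact: approx_cst|exact: approx_sub m1|lra].
have e0 : 0 < del / 2 by lra.
have [c1 [t [c10 c1c mt]]] := approx_exists m e0 bc.
exists c1, q, t, 0, (del / 2); split=> //.
- exact: le_trans c1c (leIl _ _).
- exact: approx_cst.
have := approx_dist c10 mt (approx_sub (le_trans c1c (leIr _ _)) mp).
by rewrite ler_norml => /andP[? _]; lra.
Qed.

(** If some approximation below [c] certifies a sign, [l] is kept there and replaced by 1 or -1
    elsewhere, which makes the sign uniform. Otherwise every approximation below [c] is at most its
    error in absolute value, so [l] vanishes on [c]. *)
Lemma creal_trichotomy l c : c != \bot -> exists c' l',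
  [/\ c' != \bot, (c' <= c)%O, crestr c' l = crestr c' l' &
      [\/ creal_pos l', creal_pos (- l') | l' = 0]].
Proof.
move=> c0.
have [[c' [p [e [c'0 c'c lp pe]]]]|npos] := pselect (exists c' p e,
    [/\ c' != \bot, (c' <= c)%O, approx c' l p e & 0 < p - e]).
  have [l' [l'1 l'2]] := @cond_mix _ _ (creal A) c' l (creal_cst A 1).
  exists c', l'; split=> //; constructor 1.
  apply: (creal_pos_approx (approx_restr (esym l'1) lp) pe).
  exact: approx_restr (esym l'2) (approx_cst _ _).
have [[c' [p [e [c'0 c'c lp pe]]]]|nneg] := pselect (exists c' p e,
    [/\ c' != \bot, (c' <= c)%O, approx c' l p e & 0 < - p - e]).
  have [l' [l'1 l'2]] := @cond_mix _ _ (creal A) c' l (creal_cst A (- 1)).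
  exists c', l'; split=> //; constructor 2.
  apply: (creal_pos_approx (approx_opp (approx_restr (esym l'1) lp)) pe).
  rewrite -[X in approx _ _ X _](opprK 1); apply: approx_opp.
  exact: approx_restr (esym l'2) (approx_cst _ _).
have [z [z1 z2]] := @cond_mix _ _ (creal A) c l (0 : creal1 A).
exists c, 0; split=> //; last by constructor 3.
rewrite -z1; congr (crestr c _); apply: creal_eq_approx => b del b0 del0.
have [bc|bc] := meet_case c b0; last first.
  exists b, 0, 0, 0, 0; split=> //; [|exact: approx_cst|by rewrite subr0 normr0; lra].
  by apply: approx_sub bc _; apply: approx_restr (esym z2) (approx_cst _ _).
have e0 : 0 < del / 2 by lra.
have [c1 [t [c10 c1c lt]]] := approx_exists l e0 bc.
have c1c' := le_trans c1c (leIr _ _).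
exists c1, t, 0, (del / 2), 0; split=> //; last 2 first.
- exact: approx_cst.
- rewrite (subr0 t) addr0; have [tp|tn] := leP 0 t.
    rewrite (ger0_norm tp) leNgt; apply/negP => H; apply: npos; exists c1, t, (del / 2).
    by split=> //; lra.
  rewrite (ltr0_norm tn) leNgt; apply/negP => H; apply: nneg; exists c1, t, (del / 2).
  by split=> //; lra.
- exact: le_trans c1c (leIl _ _).
- apply: approx_restr lt; symmetry; exact: cond_consistent z1.
Qed.

End CrealOrder.

(** * The dominated extension *)

Section RestrictionOperations.
Context {d : Order.disp_t} {A : cbaType d}.
Implicit Types (a c : A) (x y l : creal1 A).

Local Notation crestr := (@cond_restr _ _ (creal A)).

Lemma creal_restrD c x x' y y' : crestr c x = crestr c x' -> crestr c y = crestr c y' ->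
  crestr c (x + y) = crestr c (x' + y').
Proof.
move=> /creal_piP xx /creal_piP yy; rewrite /= !creal_restr_pi; apply/creal_piP.
exact: (lip_null lip_add).
Qed.

Lemma creal_restrM c x x' y y' : crestr c x = crestr c x' -> crestr c y = crestr c y' ->
  crestr c (x * y) = crestr c (x' * y').
Proof.
move=> /creal_piP xx /creal_piP yy; rewrite /= !creal_restr_pi; apply/creal_piP.
by apply: mul_null => //; apply: cauchyP.
Qed.

Context {X : condVect A}.

Lemma cvect_restrD c (x x' y y' : cvect1 X) :
  cond_restr (c := X) c x = cond_restr (c := X) c x' ->
  cond_restr (c := X) c y = cond_restr (c := X) c y' ->
  cond_restr (c := X) c (x + y) = cond_restr (c := X) c (x' + y').
Proof.
move=> xx yy; rewrite -!(cvect_addE (c := X)) /cond_fun1.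
have H u v : cond_restr c (cond_fun (cvect_add X) \top (u, v)) =
    cond_fun (cvect_add X) c (cond_restr c u, cond_restr c v).
  by symmetry; apply: (cond_funE (cvect_add X) c (u, v)).
by rewrite !H xx yy.
Qed.

Lemma cvect_restrZ c (l l' : creal1 A) (x x' : cvect1 X) : crestr c l = crestr c l' ->
  cond_restr (c := X) c x = cond_restr (c := X) c x' ->
  cond_restr (c := X) c (l *: x) = cond_restr (c := X) c (l' *: x').
Proof.
move=> ll xx; rewrite -!(cvect_scaleE (c := X)) /cond_fun1.
have H u v : cond_restr c (cond_fun (cvect_scale X) \top (u, v)) =
    cond_fun (cvect_scale X) c (crestr c u, cond_restr c v).
  by symmetry; apply: (cond_funE (cvect_scale X) c (u, v)).
by rewrite !H ll xx.
Qed.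

(** Let [i] be the scalar equal to 1 on [a] and to 0 off [a]. If [x] and [y] agree on [a] then
    [i *: x = i *: y], and [i * g x] agrees with [g x] on [a]. *)
Lemma linear_restr (g : cvect1 X -> creal1 A) :
  (forall l (x y : cvect1 X), g (l *: x + y) = l * g x + g y) ->
  forall a (x y : cvect1 X), cond_restr (c := X) a x = cond_restr (c := X) a y ->
    crestr a (g x) = crestr a (g y).
Proof.
move=> g_lin a x y xy.
have gZ l z : g (l *: z) = l * g z.
  have g0 : g 0 = 0.
    have := g_lin 1 0 0; rewrite scale1r mul1r addr0 => /esym/eqP.
    by rewrite -subr_eq0 addrK => /eqP.
  by rewrite -[l *: z]addr0 g_lin g0 addr0.
have [i [i1 i0]] := @cond_mix _ _ (creal A) a (1 : creal1 A) (0 : creal1 A).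
have ixy : (i : creal1 A) *: x = (i : creal1 A) *: y.
  apply: (@cond_mix_uniq _ _ X a).
    exact: cvect_restrZ (erefl (crestr a i)) xy.
  have i0Z z := cvect_restrZ i0 (erefl (cond_restr (c := X) (~` a)%O z)).
  by rewrite !i0Z !scale0r.
have gi z : crestr a (g z) = crestr a ((i : creal1 A) * g z).
  by rewrite (creal_restrM i1 (erefl (crestr a (g z)))) mul1r.
by rewrite gi -gZ ixy gZ -gi.
Qed.

End RestrictionOperations.

(** * Dominated graphs and their extension *)

Section DominatedExtension.
Context {d : Order.disp_t} {A : cbaType d} (V : lmodType (creal1 A)) (k : V -> creal1 A).
Implicit Types (a b r l m n : creal1 A) (x y z : V) (G : set (V * creal1 A)).

Local Notation crestr := (@cond_restr _ _ (creal A)).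

Context (k_convex : forall l x y, creal_le 0 l -> creal_le l 1 ->
  creal_le (k (l *: x + (1 - l) *: y)) (l * k x + (1 - l) * k y)).
Context (k_local : forall c l l' x y, crestr c l = crestr c l' ->
  crestr c (k (x + l *: y)) = crestr c (k (x + l' *: y))).

Record dominated_graph G : Prop := DominatedGraph {
  graph0 : G (0, 0);
  graphP : forall l u v, G u -> G v -> G (l *: u.1 + v.1, l * u.2 + v.2);
  graph_le : forall u, G u -> creal_le u.2 (k u.1) }.

(* [(x, a)] and [(x, b)] in a dominated graph give [(0, l (a - b))], whence
   [l (a - b) <= k 0] for every [l]. *)
Lemma dominated_graph_fun G x a b : dominated_graph G -> G (x, a) -> G (x, b) -> a = b.
Proof.
move=> HG Ga Gb; apply/eqP; rewrite -subr_eq0; apply/eqP.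
apply: (@creal_bounded_multiples_eq0 _ _ _ (k 0)) => l.
have G1 := graphP HG (-1) Gb Ga.
have /(graph_le HG) := graphP HG l G1 (graph0 HG).
rewrite /= !addr0 scaleN1r addNr scaler0.
by rewrite mulN1r addrC.
Qed.

Lemma creal_pos1 : creal_pos (1 : creal1 A).
Proof. by exists 1 => //; apply: creal_le_refl. Qed.

Lemma creal_posD m n : creal_pos m -> creal_pos n -> creal_pos (m + n).
Proof.
move=> [q q0 qm] /creal_pos_ge0 n0; exists q => //.
by rewrite -[X in creal_le X _]addr0; apply: creal_leD.
Qed.

Section OneStep.
Context (G : set (V * creal1 A)) (HG : dominated_graph G) (x0 : V).

(** The convex combination of [z - m *: x0] and [z' + m' *: x0] with weights [m' / (m + m')] and
    [m / (m + m')] is free of [x0], so domination by [k] applies to it. *)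
Lemma lower_le_upper z z' a b m m' n n' : G (z, a) -> G (z', b) ->
  creal_pos m -> creal_pos m' -> m * n = 1 -> creal_le 0 n ->
  m' * n' = 1 -> creal_le 0 n' ->
  creal_le (n * (a - k (z - m *: x0))) (n' * (k (z' + m' *: x0) - b)).
Proof.
move=> Gza Gzb m_pos m'_pos mn n0 mn' n'0.
have mm_pos := creal_posD m_pos m'_pos.
have [s mms s0] := creal_inv mm_pos.
pose l := m' * s; pose l' := m * s.
have l0 : creal_le 0 l by apply: creal_mul_ge0 => //; apply: creal_pos_ge0.
have l'0 : creal_le 0 l' by apply: creal_mul_ge0 => //; apply: creal_pos_ge0.
have l'E : 1 - l = l' by rewrite -mms /l /l' mulrDl addrK.
have l1 : creal_le l 1 by apply/creal_subr_ge0; rewrite l'E.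
have := k_convex (z - m *: x0) (z' + m' *: x0) l0 l1.
have := graphP HG l Gza (graphP HG l' Gzb (graph0 HG)).
rewrite l'E /= !addr0 => /(graph_le HG) /=.
have -> : l *: (z - m *: x0) + l' *: (z' + m' *: x0) = l *: z + l' *: z'.
  rewrite scalerBr scalerDr !scalerA /l /l' (mulrAC m' s m) (mulrAC m s m').
  by rewrite (mulrC m' m) addrACA addNr addr0.
set K := k (z - _); set K' := k (z' + _); move=> H /(creal_le_trans H)/creal_subr_ge0 {}H.
have nn0 := creal_mul_ge0 n0 n'0.
have := creal_mul_ge0 (creal_mul_ge0 nn0 (creal_pos_ge0 mm_pos)) H.
rewrite /l /l' => {}H; apply/creal_subr_ge0; move: H; congr (creal_le 0 _).
(* Multiplying by [n * n' * (m + m')] clears the weights and leaves the difference of the two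
   slopes. *)
transitivity ((n * n') * ((m + m') * s) * (m' * (K - a) + m * (K' - b))); first ring.
rewrite mms mulr1.
transitivity (n * (m' * n') * (K - a) + n' * (m * n) * (K' - b)); first ring.
rewrite mn mn'; ring.
Qed.

Lemma exists_value : exists r, forall u l, G u ->
  creal_le (u.2 + l * r) (k (u.1 + l *: x0)).
Proof.
pose S := [set t | exists z a m n, [/\ G (z, a), creal_pos m, m * n = 1, creal_le 0 n &
  t = n * (a - k (z - m *: x0))]]%classic.
have ge01 : creal_le (0 : creal1 A) 1 by exact: creal_pos_ge0 creal_pos1.
have [||r [r_ub r_lub]] := @creal_sup _ _ S.
- exists (1 * (0 - k (0 - 1 *: x0))), 0, 0, 1, 1.
  by split=> //; [exact: graph0 HG|exact: creal_pos1|exact: mulr1].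
(* Any upper slope bounds [S]; this is the one of the zero pair with [m' = 1]. *)
- exists (1 * (k (0 + 1 *: x0) - 0)) => _ [z [a [m [n [Gza m_pos mn n0 ->]]]]].
  exact: lower_le_upper Gza (graph0 HG) m_pos creal_pos1 mn n0 (mulr1 1) ge01.
exists r => -[z a] l Gza /=.
apply: creal_le_local => c c0.
have [c' [l' [c'0 c'c ll' cases]]] := creal_trichotomy l c0.
exists c', (a + l' * r), (k (z + l' *: x0)); split=> //.
- by apply: creal_restrD => //; apply: creal_restrM.
- exact: k_local.
case: cases => [m_pos|m_pos|->]; last first.
- by rewrite mul0r scale0r !addr0; apply: (graph_le HG Gza).
(* Here [- l'] is positive and serves as the [m] of an element of [S], which [r] bounds. *)
- have [n mn n0] := creal_inv m_pos.
  have /(creal_le_pM2l (creal_pos_ge0 m_pos)) : creal_le (n * (a - k (z - (- l') *: x0))) r.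
    by apply: r_ub; exists z, a, (- l'), n.
  rewrite mulrA mn mul1r scaleNr opprK => /creal_subr_ge0 H; apply/creal_subr_ge0.
  by move: H; congr (creal_le 0 _); ring.
(* Here [l'] is positive and gives an upper slope, which bounds [S] and hence the least upper bound
   [r]. *)
- have [n mn n0] := creal_inv m_pos.
  have /(creal_le_pM2l (creal_pos_ge0 m_pos)) : creal_le r (n * (k (z + l' *: x0) - a)).
    apply: r_lub => _ [z' [a' [m' [n' [Gza' m'_pos mn' n'0 ->]]]]].
    exact: lower_le_upper.
  rewrite mulrA mn mul1r => /creal_subr_ge0 H; apply/creal_subr_ge0.
  by move: H; congr (creal_le 0 _); ring.
Qed.

Lemma dominated_graph_step : exists G', [/\ dominated_graph G', (G `<=` G')%classic &
  exists r, G' (x0, r)].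
Proof.
have [r rP] := exists_value.
exists [set u | exists v l, G v /\ u = (v.1 + l *: x0, v.2 + l * r)]%classic.
split; first split.
- exists (0, 0), 0; split; first exact: graph0 HG.
  by rewrite /= scale0r mul0r !addr0.
- move=> l _ _ [u [m [Gu ->]]] [v [n [Gv ->]]] /=.
  exists (l *: u.1 + v.1, l * u.2 + v.2), (l * m + n); split; first exact: graphP HG _ _ _ Gu Gv.
  congr (_, _) => /=; last by ring.
  by rewrite scalerDr scalerA scalerDl addrACA.
- by move=> _ [u [m [Gu ->]]]; apply: rP.
- by move=> [z a] Gu; exists (z, a), 0; rewrite /= scale0r mul0r !addr0.
- exists r, (0, 0), 1; split; first exact: graph0 HG.
  by rewrite /= scale1r mul1r !add0r.
Qed.

End OneStep.

Lemma dominated_graph_total G0 : dominated_graph G0 -> exists G,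
  [/\ dominated_graph G, (G0 `<=` G)%classic & forall x, exists r, G (x, r)].
Proof.
move=> HG0.
(* Taking the union with [G0] puts the empty set in [P], as the empty chain requires. *)
pose P := [set G | dominated_graph (G `|` G0)%classic]%classic.
have [F FP Ftot|G [PG Gmax]] := @Zorn_bigcup _ P.
  split; first by right; apply: graph0 HG0.
    have join l u v H : F H -> (H `|` G0)%classic u -> (H `|` G0)%classic v ->
        ((\bigcup_(X in F) X) `|` G0)%classic (l *: u.1 + v.1, l * u.2 + v.2).
      move=> FH Hu Hv; case: (graphP (FP _ FH) l Hu Hv); last by right.
      by left; exists H.
    move=> l u v [[H FH Hu]|G0u] [[H' FH' Hv]|G0v].
    + case: (Ftot _ _ FH FH') => sub.
        by apply: (join l u v _ FH'); left => //; apply: sub.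
      by apply: (join l u v _ FH); left => //; apply: sub.
    + by apply: (join l u v _ FH); [left|right].
    + by apply: (join l u v _ FH'); [right|left].
    + by right; apply: graphP.
  move=> u [[H FH Hu]|G0u]; last exact: graph_le HG0 _ G0u.
  by apply: (graph_le (FP _ FH)); left.
exists (G `|` G0)%classic; split=> // x.
have [G' [HG' GG' [r xr]]] := dominated_graph_step PG x.
exists r; left; apply: contrapT => Gxr.
apply: (Gmax G').
  by split=> [u Gu|G'G]; [apply: GG'; left|apply: Gxr; apply: G'G].
have -> // : P G' = dominated_graph G'.
by rewrite /P /= (@setUidl _ G' G0) // => u G0u; apply: GG'; right.
Qed.

End DominatedExtension.

Local Close Scope ring_scope.
Local Close Scope order_scope.

Theorem theorem5p6 (d : Order.disp_t) (A : cbaType d) (X : condVect A)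
    (k : condFun X (creal A)) (k_convex : cond_convex k)
    (Y : condSub X) (Y_subspace : cond_subspace Y)
    (f : condFun (csub Y) (creal A))
    (f_linear : cond_linear (X := csub_vect Y_subspace) f)
    (f_le_k : forall y : csub Y Order.top, creal_le (f y) (k (sval y))) :
  exists fhat : condFun X (creal A),
    [/\ cond_linear fhat,
        (forall x : X Order.top, creal_le (fhat x) (k x)) &
        (forall y : csub Y Order.top, fhat (sval y) = f y)].
Proof.
pose G0 : set (cvect1 X * creal1 A)%type :=
  [set u | exists y : csub1 Y_subspace, u = (sval y, f y)]%classic.
have f0 : f (0%R : csub1 Y_subspace) = (0%R : creal1 A).
  have := f_linear 1%R (0%R : csub1 Y_subspace) (0%R : csub1 Y_subspace).
  rewrite scale1r mul1r (@addr0 (csub1 Y_subspace)) => f00.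
  by apply: (@addrI (creal1 A) (f (0%R : csub1 Y_subspace))); rewrite addr0 -f00.
have HG0 : dominated_graph (V := cvect1 X) k G0.
  split.
  - by exists (0%R : csub1 Y_subspace); rewrite f0.
  - move=> l _ _ [y ->] [z ->]; exists (l *: y + z)%R.
    congr (_, _); last by symmetry; apply: f_linear.
    by rewrite csub_add1E csub_scale1E.
  - by move=> _ [y ->]; apply: f_le_k.
(* [k] is a conditional function, so its value on [c] depends only on the restriction of its
   argument. *)
have k_local c (l l' : creal1 A) (x y : cvect1 X) :
    cond_restr (c := creal A) c l = cond_restr (c := creal A) c l' ->
    cond_restr (c := creal A) c (k (x + l *: y)%R) =
    cond_restr (c := creal A) c (k (x + l' *: y)%R).
  move=> ll; rewrite -!cond_funE; congr (cond_fun k c _).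
  by apply: cvect_restrD => //; apply: cvect_restrZ.
have [G [HG G0G /boolp.choice[g gP]]] :=
  dominated_graph_total (V := cvect1 X) k_convex k_local HG0.
have g_lin (l : creal1 A) (x y : cvect1 X) : g (l *: x + y)%R = (l * g x + g y)%R.
  exact: dominated_graph_fun HG (gP _) (graphP HG l (gP x) (gP y)).
pose fhat := condFun_of_local (Y := creal A) (linear_restr g_lin).
have fhatE x : fhat x = g x by exact: condFun_of_localE.
exists fhat; split.
- by move=> l x y; rewrite !fhatE; apply: g_lin.
- by move=> x; rewrite fhatE; apply: (graph_le HG (gP x)).
- move=> y; rewrite fhatE; apply: dominated_graph_fun HG (gP _) _.
  by apply: G0G; exists y.
Qed.
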